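(* Let $f:\mathbb{R}^d\to(0,\infty]$ be a density satisfying assumption (A) with constants $C_1,C_2\ge1$, let $M_1:=f(1,0,\ldots,0)\,|B_{1/2}(0)|$ and $M_2:=(C_1\vee C_2)\|f\|_1$. Then the following hold. (a) If there exists a constant $C>0$ such that $h_2(x)<C$ for all $x\in\mathbb{R}^d$, then $$n(M_1/2)^{n-1}f(x)\le f^{n\star}(x)\le n(M_2+C)^{n-1}f(x),\qquad |x|\ge1,\ n\in\mathbb{N},$$ and $$e^{((M_1/2)-\|f\|_1)\lambda}\,\lambda f(x)\le p_\lambda(x)\le e^{(M_2+C-\|f\|_1)\lambda}\,\lambda f(x),\qquad |x|\ge1,\ \lambda>0.$$ (b) If $g_2(x)\to\infty$ as $|x|\to\infty$ or, equivalently, $h_2(x)\to\infty$ as $|x|\to\infty$, then, for every $n\in\mathbb{N}$, $$\frac{f^{n\star}(x)}{f(x)}=g_n(x)(1+o(1))=h_n(x)(1+o(1))\quad\text{as }|x|\to\infty.$$ In particular, for all $1\le m<n$, $$\frac{f^{n\star}(x)}{f^{m\star}(x)}\to\infty\quad\text{as }|x|\to\infty,$$ and, for any $n\in\mathbb{N}$ and $\lambda>0$, $$\frac{p_\lambda(x)}{f^{n\star}(x)}\to\infty\quad\text{as }|x|\to\infty.$$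
   Context: Let $d\ge 1$, $\mathbb{N}=\{1,2,\dots\}$, $a\vee b=\max(a,b)$; $|x|$ is the Euclidean norm, $B_r(x)$ the open Euclidean ball, $|B|$ the Lebesgue measure of $B$, and $\|f\|_1$ the $L^1(\mathbb{R}^d)$ norm. A density is a nonnegative nonzero function in $L^1(\mathbb{R}^d)$. ''Decreasing'' is meant in the non-strict sense; a function is radial decreasing if $f(x)=F(|x|)$ with $F$ nonincreasing on $[0,\infty)$. Convolutions: $f^{1\star}:=f$, $f^{n\star}(x):=\int_{\mathbb{R}^d}f(x-y)f^{(n-1)\star}(y)\,dy$ for $n\ge2$. For $\lambda>0$ the density of the compound Poisson measure built for $f$ is $$p_\lambda(x)=e^{-\lambda\|f\|_1}\sum_{n=1}^\infty\frac{\lambda^nf^{n\star}(x)}{n!}.$$ Assumption (A): $f:\mathbb{R}^d\to(0,\infty]$ is a density such that (a) $f$ is a radial decreasing function; (b) there is a constant $C_1\ge1$ such that $f(x)\le C_1f(y)$ for $1\le|x|\le|y|\le|x|+1$; (c) there is a constant $C_2\ge1$ such that $f(x)\le C_2f(2x)$ for $|x|\le1$. Functions $h_n,g_n$: $h_1\equiv g_1\equiv1$ on $\mathbb{R}^d$ and, for $n\in\mathbb{N}$, $$h_{n+1}(x):=\frac{\int_{D(x)}f(x-y)f(y)h_n(y)\,dy}{f(x)},\qquad g_{n+1}(x):=\frac{\int_{E(x)}f(x-y)f(y)g_n(y)\,dy}{f(x)},$$ where $D(x)=\{z\in\mathbb{R}^d:|z|<|x|-1,\ |x-z|<|x|-1\}$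 and $E(x)=\{z\in\mathbb{R}^d:|z|<|x|,\ |x-z|<|x|\}$. An integral over the empty set equals $0$ and $a/(+\infty)=0$ for $a\ge0$. *)

(* Defs.v *)
From HB Require Import structures.
From mathcomp Require Import all_boot all_order all_algebra.
From mathcomp Require Import all_classical all_reals all_analysis.
Import Order.TTheory GRing.Theory Num.Theory.
Import numFieldNormedType.Exports.

Set Implicit Arguments.
Unset Strict Implicit.
Unset Printing Implicit Defensive.

Local Open Scope classical_set_scope.
Local Open Scope ring_scope.

Definition rV_display : measure_display.
Proof. exact: default_measure_display. Qed.

Section measurable_rV.
Context {R : realType} {n : nat}.

Let coord (i : 'I_n) (x : 'rV[R]_n) : R := x ord0 i.

(* The sigma-algebra generated by the coordinates, that is the Borel one. *)
HB.instance Definition _ := @isMeasurable.Build rV_display 'rV[R]_n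
  (g_sigma_preimage coord) (@sigma_algebra0 _ _ _)
  (@sigma_algebraC _ _) (@sigma_algebra_bigcup _ _ _).

End measurable_rV.

Lemma measurable_coord_rV (R : realType) n (i : 'I_n) :
  measurable_fun [set: 'rV[R]_n] (fun x : 'rV[R]_n => x ord0 i).
Proof.
move=> _ Y mY; rewrite setTI; apply: sub_sigma_algebra => /=.
rewrite -bigcup_seq/=; exists i => /=; first by rewrite mem_index_enum.
by exists Y => //; rewrite setTI.
Qed.

Lemma measurable_fun_rVP d (T : measurableType d) (R : realType) n
    (f : T -> 'rV[R]_n) :
  (forall i, measurable_fun [set: T] (fun x => f x ord0 i)) ->
  measurable_fun [set: T] f.
Proof.
move=> mf _ Y mY; rewrite setTI.
have : g_sigma_preimage (fun i (x : T) => f x ord0 i) (f @^-1` Y).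
  rewrite (g_sigma_preimage_comp (fun i (x : 'rV[R]_n) => x ord0 i) f).
  by exists Y => //; rewrite setTI.
move: (f @^-1` Y); apply: smallest_sub; first exact: sigma_algebra_measurable.
move=> A; rewrite -bigcup_seq/= => -[i _ [B mB <-]].
exact: mf.
Qed.

Section lebesgue_measure_rV.
Context {R : realType}.

Definition cons_rV n (p : measurableTypeR R * 'rV[R]_n) : 'rV[R]_n.+1 :=
  row_mx p.1%:M p.2.

Definition uncons_rV n (x : 'rV[R]_n.+1) :
    measurableTypeR R * 'rV[R]_n :=
  (x ord0 ord0, \row_i x ord0 (lift ord0 i)).

Lemma cons_rV0 n (p : measurableTypeR R * 'rV[R]_n) : cons_rV p ord0 ord0 = p.1.
Proof.
rewrite /cons_rV (_ : (ord0 : 'I_n.+1) = lshift n (ord0 : 'I_1)).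
  by rewrite (row_mxEl (p.1)%:M) mxE eqxx.
exact: val_inj.
Qed.

Lemma cons_rVS n (p : measurableTypeR R * 'rV[R]_n) i :
  cons_rV p ord0 (lift ord0 i) = p.2 ord0 i.
Proof.
rewrite /cons_rV (_ : lift ord0 i = rshift 1 i); last exact: val_inj.
by rewrite (row_mxEr (p.1)%:M).
Qed.

Lemma cons_rVK n : cancel (@cons_rV n) (@uncons_rV n).
Proof.
case=> t y; rewrite /uncons_rV cons_rV0; congr pair.
by apply/rowP => i; rewrite mxE cons_rVS.
Qed.

Lemma measurable_cons_rV n : measurable_fun setT (@cons_rV n).
Proof.
apply: measurable_fun_rVP => i.
have [j ->|->] := unliftP ord0 i.
  under eq_fun do rewrite cons_rVS.
  have := measurableT_comp (measurable_coord_rV j) (@measurable_snd _ _ _ _).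
  exact.
under eq_fun do rewrite cons_rV0.
exact: measurable_fst.
Qed.

Lemma measurable_uncons_rV n : measurable_fun setT (@uncons_rV n).
Proof.
apply: measurable_fun_pair; first exact: measurable_coord_rV.
apply: measurable_fun_rVP => i.
under eq_fun do rewrite mxE.
exact: measurable_coord_rV.
Qed.

Local Open Scope ereal_scope.

Section prod_lebesgue_rV.
Variables (n : nat) (mu : {sigma_finite_measure set 'rV[R]_n -> \bar R}).

Definition prod_lebesgue_rV : set 'rV[R]_n.+1 -> \bar R :=
  pushforward (lebesgue_measure \x mu) (@cons_rV n).

Let nu : {measure set 'rV[R]_n.+1 -> \bar R} :=
  measure_function_pushforward__canonical__measure_function_Measure
    (lebesgue_measure \x mu) (@measurable_cons_rV n).

HB.instance Definition _ := isMeasure.Build _ _ _ prod_lebesgue_rV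
  (measure0 nu) (measure_ge0 nu) (@measure_semi_sigma_additive _ _ _ nu).

Let prod_lebesgue_rV_sigma_finite : sigma_finite setT prod_lebesgue_rV.
Proof.
pose m1 : {sigma_finite_measure set (measurableTypeR R) -> \bar R} :=
  lebesgue_measure.
have /sigma_finiteP[F [TF ndF Foo]] := sigma_finiteT m1.
have /sigma_finiteP[G [TG ndG Goo]] := sigma_finiteT mu.
exists (fun k => @uncons_rV n @^-1` (F k `*` G k)).
  apply/esym/seteqP; split=> // x _.
  have [k _ Fk] : (\bigcup_k F k) (uncons_rV x).1 by rewrite -TF.
  have [l _ Gl] : (\bigcup_k G k) (uncons_rV x).2 by rewrite -TG.
  exists (maxn k l) => //; split.
    by move: Fk; exact/subsetPset/ndF/leq_maxl.
  by move: Gl; exact/subsetPset/ndG/leq_maxr.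
move=> k; have [mF Fk] := Foo k; have [mG Gk] := Goo k; split.
  rewrite -[X in measurable X]setTI; apply: measurable_uncons_rV => //.
  exact: measurableX.
rewrite /prod_lebesgue_rV /pushforward -comp_preimage.
rewrite (_ : _ \o _ = id); last by apply/funext => p /=; rewrite cons_rVK.
by rewrite preimage_id product_measure1E// lte_mul_pinfty// ge0_fin_numE.
Qed.

HB.instance Definition _ := Measure_isSigmaFinite.Build _ _ _ prod_lebesgue_rV
  prod_lebesgue_rV_sigma_finite.

End prod_lebesgue_rV.

Fixpoint lebesgue_rV n : {sigma_finite_measure set 'rV[R]_n -> \bar R} :=
  match n with
  | 0 => \d_(0%R : 'rV[R]_0)
  | m.+1 => prod_lebesgue_rV (lebesgue_rV m)
  end.

Lemma lebesgue_rV_box n (A : 'I_n -> set R) :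
  (forall i, measurable (A i)) ->
  lebesgue_rV n [set x : 'rV[R]_n | forall i, A i (x ord0 i)] =
  \prod_(i < n) lebesgue_measure (A i).
Proof.
elim: n A => [|n IHn] A mA.
  by rewrite big_ord0 /= diracE mem_set//= => -[].
rewrite big_ord_recl -IHn//= -product_measure1E//; last first.
  rewrite (_ : mkset _ = \big[setI/setT]_(i < n)
      ((fun x : 'rV[R]_n => x ord0 i) @^-1` A (lift ord0 i))); last first.
    rewrite -bigcap_seq; apply/seteqP; split=> x /= Ax i; first by move=> _.
    by apply: Ax => /=; rewrite mem_index_enum.
  apply: bigsetI_measurable => i _; rewrite -[X in measurable X]setTI.
  exact: measurable_coord_rV.
exact: mA.
rewrite /prod_lebesgue_rV /pushforward.
congr (product_measure1 _ _ _); apply/seteqP; split=> -[t y] /=.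
  move=> Aty; split=> [|i].
    by have := Aty ord0; rewrite cons_rV0.
  by have := Aty (lift ord0 i); rewrite cons_rVS.
move=> [At Ay] i; have [j ->|->] := unliftP ord0 i.
  by rewrite cons_rVS.
by rewrite cons_rV0.
Qed.

End lebesgue_measure_rV.
Arguments lebesgue_rV {R} n.

Section definitions.
Context {R : realType} {d : nat}.
Local Notation V := 'rV[R]_d.
Implicit Types (f u v : V -> \bar R) (x y z : V).

(* The norm `|x| that the library puts on 'rV[R]_d is the sup norm. *)
Definition enorm x : R := Num.sqrt (\sum_i x ord0 i ^+ 2).

Definition eball x (r : R) : set V := [set y | enorm (y - x) < r].

Definition e1 : V := \row_i (i == 0 :> nat)%:R.

(* The filter of the limits as |x| tends to infinity. *)
Definition enorm_infty : set_system V :=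
  filter_from [set: R] (fun r => [set x | r < enorm x]).

Global Instance enorm_infty_filter : Filter enorm_infty.
Proof.
apply: filter_from_filter; first by exists 0.
move=> r s _ _; exists (Num.max r s) => // x /=.
by rewrite gt_max => /andP[].
Qed.

Local Open Scope ereal_scope.

Definition L1norm f : R := fine 'N[lebesgue_rV d]_1[f].

Definition density f : Prop :=
  [/\ forall x, 0 <= f x,
      (lebesgue_rV d).-integrable [set: V] f &
      ~ {ae lebesgue_rV d, forall x, f x = 0}].

Definition radial_decreasing f : Prop :=
  exists F : R -> \bar R,
    (forall r s : R, (0 <= r)%R -> (r <= s)%R -> F s <= F r) /\
    (forall x, f x = F (enorm x)).

Record assumption_A f (C1 C2 : R) : Prop := {
  A_gt0 : forall x, 0 < f x;
  A_density : density f;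
  A_radial_decreasing : radial_decreasing f;
  A_C1_ge1 : (1 <= C1)%R;
  A_C1 : forall x y, (1 <= enorm x)%R -> (enorm x <= enorm y)%R ->
    (enorm y <= enorm x + 1)%R -> f x <= C1%:E * f y;
  A_C2_ge1 : (1 <= C2)%R;
  A_C2 : forall x, (enorm x <= 1)%R -> f x <= C2%:E * f (2 *: x)%R
}.

(* [conv_pow f n] is the n-th convolution power of f for n >= 1; its value
   for n = 0 is irrelevant. *)
Fixpoint conv_pow f n : V -> \bar R :=
  match n with
  | 0 => cst 0
  | m.+1 => if m is 0 then f else
      fun x => \int[lebesgue_rV d]_y (f (x - y)%R * conv_pow f m y)
  end.

Definition poisson_density f (lambda : R) x : \bar R :=
  (expR (- lambda * L1norm f))%:E *
  \sum_(1 <= n <oo) ((lambda ^+ n / n`!%:R)%:E * conv_pow f n x).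

(* Common recursion of h_n and g_n, indexed from n = 1; the value for n = 0
   is irrelevant. In \bar R, a / +oo = 0 holds by definition. *)
Fixpoint ratio_seq (D : V -> set V) f n : V -> \bar R :=
  match n with
  | 0 => cst 0
  | m.+1 => if m is 0 then cst 1 else
      fun x => (\int[lebesgue_rV d]_(y in D x)
                  (f (x - y)%R * f y * ratio_seq D f m y)) / f x
  end.

Definition D_set x : set V :=
  [set z | (enorm z < enorm x - 1)%R /\ (enorm (x - z) < enorm x - 1)%R].

Definition E_set x : set V :=
  [set z | (enorm z < enorm x)%R /\ (enorm (x - z) < enorm x)%R].

Definition h_ f n : V -> \bar R := ratio_seq D_set f n.

Definition g_ f n : V -> \bar R := ratio_seq E_set f n.

(* u(x) = v(x) (1 + o(1)) as |x| tends to infinity. *)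
Definition equiv_infty u v : Prop :=
  exists2 eps : V -> R,
    eps x @[x --> enorm_infty] --> (0 : R)%R &
    \forall x \near enorm_infty, u x = v x * (1 + eps x)%:E.

End definitions.
Arguments e1 {R} d.
Arguments enorm_infty {R} d.

(* Main.v *)
Require Import Defs.
From HB Require Import structures.
From mathcomp Require Import all_boot all_order all_algebra.
From mathcomp Require Import all_classical all_reals all_analysis.
From mathcomp Require Import measurable_realfun.
From mathcomp Require Import ring lra.
Import Order.TTheory GRing.Theory Num.Theory.
Import numFieldNormedType.Exports.

Set Implicit Arguments.
Unset Strict Implicit.
Unset Printing Implicit Defensive.

(** Write U n for the convolution power of f with n + 1 factors, and L for the
    L1 norm of f.  Three facts carry the proof.

    Splitting ([convol_le_split]).  If, for every y off a set S, one of the two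
    factors of f (x - y) u(y) is small, f (x - y) <= b or u y <= a, then the
    convolution of f and u at x is at most a |f|_1 + b |u|_1 plus the integral
    over S.  Each upper bound below is an instance of this for a suitable S.

    Monotonicity ([convol_norm_decreasing]).  The convolution of two radially
    decreasing functions is radially decreasing, so that a power may be
    estimated at a point of a convenient norm and direction.  For |x| <= |y|,
    let s be the reflection that exchanges x and y: averaging the integrands at
    z and s z reduces the claim to the rearrangement inequality for two pairs of
    numbers.  This uses that Lebesgue measure is invariant under isometries
    ([lebesgue_rV_isometry]), which follows from its invariance under
    translations by Tonelli's theorem.

    Shifting ([f_shift]).  By assumption (b), f y <= C1^k f x as soon as
    |y| >= |x| - k >= 1.

    Bounds (a).  Below, U n.+1 x is at least the integral over a ball of radius
    1/2 that lies within distance 1 of x and inside the ball of radius |x|.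
    Above, for |x| > 2 split over S = D(x): off D(x) one of the factors is
    O(f x) by shifting, and on D(x) the induction hypothesis and the bound on
    h_2 apply.  For |x| <= 2 take S empty, since y or x - y has norm at least
    |x| / 2, where assumption (c) compares f with f x.  The bounds on the
    compound Poisson density follow by summation.

    Asymptotics (b).  The hypothesis gives f = o(U 1), and splitting over
    {|y| >= k} propagates it to U n = o(U n.+1) ([negligible_conv_powS]).  Let
    N n x = f x * h_(n+1) x, so that N n.+1 x is the integral over D(x) of
    f (x - y) N n y.  Splitting U n.+1 x over the y in D(x) with |y| >= k, the
    terms outside of the integral are O(f x) and O(U n x), hence
    o(U n.+1 x), while the integral is at most (1 + o(1)) N n.+1 x by induction
    ([conv_pow_le_numerator]).  As N n is at most f g_(n+1), which is at most
    U n, all three are equivalent.  The other limits come from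
    U n = o(U n.+1). *)

Local Open Scope classical_set_scope.
Local Open Scope ring_scope.

(** * The Euclidean norm and reflections *)

Section euclidean_norm.
Context {R : realType} {d : nat}.
Local Notation V := 'rV[R]_d.
Implicit Types (x y z w : V) (t : R).

Definition dotv x y : R := \sum_i x ord0 i * y ord0 i.

Lemma dotvC x y : dotv x y = dotv y x.
Proof. by apply: eq_bigr => i _; rewrite mulrC. Qed.

Lemma dotvDl x y z : dotv (x + y) z = dotv x z + dotv y z.
Proof. by rewrite -big_split; apply: eq_bigr => i _; rewrite mxE mulrDl. Qed.

Lemma dotvZl t x y : dotv (t *: x) y = t * dotv x y.
Proof. by rewrite mulr_sumr; apply: eq_bigr => i _; rewrite mxE mulrA. Qed.

Lemma dotvNl x y : dotv (- x) y = - dotv x y.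
Proof. by rewrite -scaleN1r dotvZl mulN1r. Qed.

Lemma dotvDr x y z : dotv z (x + y) = dotv z x + dotv z y.
Proof. by rewrite !(dotvC z) dotvDl. Qed.

Lemma dotvZr t x y : dotv y (t *: x) = t * dotv y x.
Proof. by rewrite !(dotvC y) dotvZl. Qed.

Lemma dotvNr x y : dotv y (- x) = - dotv y x.
Proof. by rewrite !(dotvC y) dotvNl. Qed.

Definition dotvE := (dotvDl, dotvDr, dotvZl, dotvZr, dotvNl, dotvNr).

Lemma dotvv_ge0 x : 0 <= dotv x x.
Proof. by apply: sumr_ge0 => i _; rewrite -expr2 sqr_ge0. Qed.

Lemma dotvv_eq0 x : (dotv x x == 0) = (x == 0).
Proof.
apply/eqP/eqP => [x0|->]; last first.
  by rewrite /dotv big1// => i _; rewrite mxE mul0r.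
apply/rowP => i; rewrite mxE; apply/eqP; rewrite -sqrf_eq0 expr2.
by move/psumr_eq0P: x0 => -> // j _; rewrite -expr2 sqr_ge0.
Qed.

Lemma enormE x : enorm x = Num.sqrt (dotv x x).
Proof. by congr Num.sqrt; apply: eq_bigr => i _; rewrite expr2. Qed.

Lemma enorm_sqr x : enorm x ^+ 2 = dotv x x.
Proof. by rewrite enormE sqr_sqrtr ?dotvv_ge0. Qed.

Lemma enorm_ge0 x : 0 <= enorm x. Proof. exact: sqrtr_ge0. Qed.

Lemma ler_enorm x y : (enorm x <= enorm y) = (dotv x x <= dotv y y).
Proof. by rewrite !enormE ler_sqrt ?dotvv_ge0. Qed.

Lemma enorm_eq0 x : (enorm x == 0) = (x == 0).
Proof. by rewrite -sqrf_eq0 enorm_sqr dotvv_eq0. Qed.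

Lemma enorm0 : enorm (0 : V) = 0.
Proof. by apply/eqP; rewrite enorm_eq0. Qed.

Lemma enormN x : enorm (- x) = enorm x.
Proof. by rewrite !enormE !dotvE opprK. Qed.

Lemma enorm_distC x y : enorm (x - y) = enorm (y - x).
Proof. by rewrite -enormN opprB. Qed.

Lemma enormZ t x : enorm (t *: x) = `|t| * enorm x.
Proof. by rewrite !enormE !dotvE mulrA -expr2 sqrtrM ?sqr_ge0// sqrtr_sqr. Qed.

(** The square of |y| x - |x| y is nonnegative. *)
Lemma dotv_le_enorm x y : dotv x y <= enorm x * enorm y.
Proof.
have [->|x0] := eqVneq x 0.
  by rewrite -(scale0r (0 : V)) dotvZl mul0r mulr_ge0 ?enorm_ge0.
have [->|y0] := eqVneq y 0.
  by rewrite -(scale0r (0 : V)) dotvZr mul0r mulr_ge0 ?enorm_ge0.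
have xy0 : 0 < enorm x * enorm y.
  by rewrite mulr_gt0 ?lt0r ?enorm_eq0 ?x0 ?y0 ?enorm_ge0.
rewrite -(ler_pM2l xy0) -subr_ge0.
have := dotvv_ge0 (enorm y *: x - enorm x *: y).
rewrite !dotvE -!enorm_sqr (dotvC y x); nra.
Qed.

Lemma enormD x y : enorm (x + y) <= enorm x + enorm y.
Proof.
rewrite -ler_sqr ?nnegrE ?addr_ge0 ?enorm_ge0// enorm_sqr !dotvE (dotvC y x).
rewrite -!enorm_sqr.
have := dotv_le_enorm x y; nra.
Qed.

Lemma enormB x y : enorm x - enorm y <= enorm (x - y).
Proof. by rewrite lerBlDr -{1}(subrK y x) enormD. Qed.

Lemma coord_le_enorm x i : `|x ord0 i| <= enorm x.
Proof.
rewrite -sqrtr_sqr ler_sqrt; last first.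
  by apply: sumr_ge0 => j _; rewrite sqr_ge0.
by rewrite (bigD1 i)//= lerDl sumr_ge0// => j _; rewrite sqr_ge0.
Qed.

Definition reflection w z : V := z - (2 * dotv z w / dotv w w) *: w.

Lemma dotv_reflection w z z' : w != 0 ->
  dotv (reflection w z) (reflection w z') = dotv z z'.
Proof.
rewrite -dotvv_eq0 => w0; rewrite /reflection !dotvE (dotvC w z'); field.
exact: w0.
Qed.

Lemma enorm_reflection w z : w != 0 -> enorm (reflection w z) = enorm z.
Proof. by move=> w0; rewrite !enormE dotv_reflection. Qed.

Lemma reflectionD w z z' : reflection w (z + z') = reflection w z + reflection w z'.
Proof.
rewrite /reflection dotvDl mulrDr mulrDl scalerDl opprD !addrA; congr (_ + _).
by rewrite addrAC.
Qed.

Lemma reflectionB w z z' : reflection w (z - z') = reflection w z - reflection w z'.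
Proof.
by apply/eqP; rewrite eq_sym subr_eq -reflectionD subrK.
Qed.

Lemma reflectionK w : w != 0 -> involutive (reflection w).
Proof.
rewrite -dotvv_eq0 => w0 z; rewrite /reflection !dotvE.
rewrite -addrA -opprD -scalerDl; set k := (X in X *: _).
suff -> : k = 0 by rewrite scale0r subr0.
by rewrite /k; field; exact: w0.
Qed.

Lemma reflection_id w : w != 0 -> reflection w w = - w.
Proof.
rewrite -dotvv_eq0 => w0; rewrite /reflection -mulrA divff// mulr1 scaler_nat.
by rewrite mulr2n opprD addrA subrr sub0r.
Qed.

(** The reflection in the bisecting hyperplane of x and y: the linear
    reflection that maps x - y to its opposite, conjugated so that x goes to y. *)
Definition bisect_reflection x y z : V := reflection (x - y) (z - x) + y.

Lemma enorm_bisect_swap x y z : x != y ->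
  enorm (y - bisect_reflection x y z) = enorm (x - z).
Proof.
move=> xy; rewrite /bisect_reflection opprD addrCA subrr addr0 enormN.
by rewrite enorm_reflection ?subr_eq0// enorm_distC.
Qed.

Lemma enorm_bisect_swapr x y z : x != y ->
  enorm (x - bisect_reflection x y z) = enorm (y - z).
Proof.
move=> xy; have w0 : x - y != 0 by rewrite subr_eq0.
rewrite -(enorm_reflection _ w0); congr enorm.
rewrite /bisect_reflection opprD addrA addrAC (reflectionB _ (x - y)) reflectionK//.
rewrite reflection_id//; apply/rowP => i; rewrite !mxE; ring.
Qed.

Lemma bisect_reflectionK x y z : x != y ->
  bisect_reflection x y (bisect_reflection x y z) = z.
Proof.
move=> xy; have w0 : x - y != 0 by rewrite subr_eq0.
rewrite /bisect_reflection -(addrA _ y) -(opprB x y).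
rewrite (reflectionB _ (reflection _ _)) reflectionK//.
rewrite reflection_id//; apply/rowP => i; rewrite !mxE; ring.
Qed.

(** The hypotheses put z and the origin on the same side of the bisecting
    hyperplane, and a reflection that takes z to the other side moves it away
    from the origin. *)
Lemma enorm_le_bisect x y z : enorm x <= enorm y ->
  enorm (x - z) <= enorm (y - z) -> enorm z <= enorm (bisect_reflection x y z).
Proof.
have [<-|xy] := eqVneq x y.
  by rewrite /bisect_reflection /reflection !subrr scaler0 subr0 subrK.
have w0 : dotv (x - y) (x - y) != 0 by rewrite dotvv_eq0 subr_eq0.
have w1 : 0 < dotv (x - y) (x - y) by rewrite lt0r w0 dotvv_ge0.
rewrite !ler_enorm /bisect_reflection /reflection => xy1.
have -> : z - x - (2 * dotv (z - x) (x - y) / dotv (x - y) (x - y)) *: (x - y) + y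
  = z - ((2 * dotv (z - x) (x - y) / dotv (x - y) (x - y)) + 1) *: (x - y).
  by apply/rowP => i; rewrite !mxE; ring.
set k := _ + 1.
have kE : k * dotv (x - y) (x - y) = 2 * dotv z (x - y) + (dotv y y - dotv x x).
  rewrite /k mulrDl divfK// !dotvE (dotvC y x); ring.
move: kE w1; rewrite !dotvE (dotvC y x) (dotvC x z) (dotvC y z) => kE w1 xz.
have k0 : 0 <= k.
  rewrite -(pmulr_lge0 _ w1) kE; nra.
nra.
Qed.

End euclidean_norm.

(** * Measurability of vector operations *)

Section measurability.
Context {R : realType} {d : nat}.
Local Notation V := 'rV[R]_d.

Lemma measurable_rVD disp (T : measurableType disp) (u v : T -> V) :
  measurable_fun setT u -> measurable_fun setT v ->
  measurable_fun setT (fun t => u t + v t).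
Proof.
move=> mu mv; apply: measurable_fun_rVP => i; under eq_fun do rewrite mxE.
by apply: measurable_funD; exact: measurableT_comp (measurable_coord_rV i) _.
Qed.

Lemma measurable_rVZ disp (T : measurableType disp) (k : T -> R) (u : T -> V) :
  measurable_fun setT k -> measurable_fun setT u ->
  measurable_fun setT (fun t => k t *: u t).
Proof.
move=> mk mu; apply: measurable_fun_rVP => i; under eq_fun do rewrite mxE.
by apply: measurable_funM => //; exact: measurableT_comp (measurable_coord_rV i) _.
Qed.

Lemma measurable_rVN disp (T : measurableType disp) (u : T -> V) :
  measurable_fun setT u -> measurable_fun setT (fun t => - u t).
Proof.
move=> mu; under eq_fun do rewrite -scaleN1r.
exact: measurable_rVZ.
Qed.

Lemma measurable_dotv disp (T : measurableType disp) (u v : T -> V) :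
  measurable_fun setT u -> measurable_fun setT v ->
  measurable_fun setT (fun t => dotv (u t) (v t)).
Proof.
move=> mu mv; apply: measurable_sum => i.
by apply: measurable_funM; exact: measurableT_comp (measurable_coord_rV i) _.
Qed.

Lemma measurable_enorm disp (T : measurableType disp) (u : T -> V) :
  measurable_fun setT u -> measurable_fun setT (fun t => enorm (u t)).
Proof.
move=> mu; under eq_fun do rewrite enormE.
apply: measurableT_comp; last exact: measurable_dotv.
exact: (continuous_measurable_fun (@sqrt_continuous R)).
Qed.

Lemma measurable_reflection w : measurable_fun setT (@reflection R d w).
Proof.
apply: measurable_rVD => //; apply: measurable_rVN; apply: measurable_rVZ => //.
apply: measurable_funM => //; apply: measurable_funM => //.
exact: measurable_dotv.
Qed.

Lemma measurable_set_ltr disp (T : measurableType disp) (a b : T -> R) :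
  measurable_fun setT a -> measurable_fun setT b ->
  measurable [set t | a t < b t].
Proof.
move=> ma mb; rewrite -[X in measurable X]setTI.
have := measurable_fun_ltr ma mb measurableT (Y := [set true]).
exact.
Qed.

Lemma measurable_eball c r : measurable (eball c r : set V).
Proof.
apply: measurable_set_ltr => //; apply: measurable_enorm.
exact: measurable_rVD.
Qed.

End measurability.

(** * Translation invariance of Lebesgue measure *)

Section translation.
Context {R : realType}.
Local Open Scope ereal_scope.

Lemma lebesgue_measure_translation (c : R) (A : set R) : measurable A ->
  pushforward lebesgue_measure ((fun t => t + c)%R : _ -> measurableTypeR R) A
  = lebesgue_measure A.
Proof.
have mc : measurable_fun setT
    ((fun t => t + c)%R : measurableTypeR R -> measurableTypeR R).
  exact: measurable_funD.
move=> mA; apply/esym.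
pose nu : {measure set (measurableTypeR R) -> \bar R} :=
    measure_function_pushforward__canonical__measure_function_Measure
    lebesgue_measure mc.
apply: (@lebesgue_measure_unique _ nu) => //= _ [[a b]] _ <-.
rewrite /nu /= /pushforward.
have -> : (fun t => t + c)%R @^-1` [set` `]a, b]] = [set` `](a - c)%R, (b - c)%R]].
  by apply/seteqP; split => t /=; rewrite !in_itv/= ltrBlDr lerBrDr.
rewrite !lebesgue_measure_itv/= !lte_fin ltrD2r.
by case: ifP => // _; rewrite -!EFinB; congr EFin; ring.
Qed.

Lemma ge0_integral_translation1 (c : R) (G : measurableTypeR R -> \bar R) :
  measurable_fun setT G -> (forall t, 0 <= G t) ->
  \int[lebesgue_measure]_t G (t + c)%R = \int[lebesgue_measure]_t G t.
Proof.
move=> mG G0.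
have mc : measurable_fun setT
    ((fun t => t + c)%R : measurableTypeR R -> measurableTypeR R).
  exact: measurable_funD.
have := @ge0_integral_pushforward _ _ _ _ _ _ mc lebesgue_measure setT G
  measurableT mG (fun y _ => G0 y).
rewrite preimage_setT => <-; apply: eq_measure_integral => A mA _.
exact: lebesgue_measure_translation.
Qed.

(** By induction on the dimension: a translation of R^(n+1) translates the
    slices, whose measures do not change, and shifts the first coordinate. *)
Lemma lebesgue_rV_translation n (c : 'rV[R]_n) (A : set 'rV[R]_n) : measurable A ->
  lebesgue_rV n ((fun x => x + c)%R @^-1` A) = lebesgue_rV n A.
Proof.
elim: n c A => [|n IH] c A mA.
  congr (lebesgue_rV 0 _); apply/seteqP; split => x /=;
  by rewrite (_ : (x + c)%R = x)//; apply/rowP => -[].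
have mB B : measurable B -> measurable (@cons_rV R n @^-1` B).
  by move=> mB; rewrite -[X in measurable X]setTI; exact: measurable_cons_rV.
rewrite /= /prod_lebesgue_rV /pushforward /= /product_measure1.
pose G t := (lebesgue_rV n \o xsection (cons_rV (n:=n) @^-1` A)) t.
transitivity (\int[lebesgue_measure]_t G (t + c ord0 ord0)%R); last first.
  apply: ge0_integral_translation1 => //.
  exact: measurable_fun_xsection (mB _ mA).
apply: eq_integral => t _ /=; rewrite /G /=.
rewrite -(IH (\row_i c ord0 (lift ord0 i))
  (xsection (cons_rV (n:=n) @^-1` A) (t + c ord0 ord0)%R));
  last exact: (measurable_xsection _ (mB _ mA)).
have E y : cons_rV ((t + c ord0 ord0)%R, (y + \row_i c ord0 (lift ord0 i))%R)
    = (cons_rV (t, y) + c)%R.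
  apply/rowP => i; rewrite [RHS]mxE; have [j ->|->] := unliftP ord0 i.
    by rewrite !cons_rVS/= !mxE.
  by rewrite !cons_rV0.
by congr (lebesgue_rV n _); apply/seteqP; split => y; rewrite /= !xsectionE /= E.
Qed.

End translation.

(** * Balls and isometries *)

Lemma pmule_inj (R : realDomainType) (b p q : \bar R) :
  b \is a fin_num -> (0 < b -> b * p = b * q -> p = q)%E.
Proof.
by move=> bfin b0 E; apply/le_anti/andP; split; rewrite -(lee_pmul2l bfin b0) E.
Qed.

Section lebesgue_rV_integral.
Context {R : realType} {d : nat}.
Local Notation V := 'rV[R]_d.
Local Notation mu := (lebesgue_rV d).
Local Open Scope ereal_scope.

Lemma ge0_integral_preserving (phi : V -> V) (G : V -> \bar R) :
  measurable_fun setT phi ->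
  (forall A, measurable A -> mu (phi @^-1` A) = mu A) ->
  measurable_fun setT G -> (forall x, 0 <= G x) ->
  \int[mu]_x G (phi x) = \int[mu]_x G x.
Proof.
move=> mphi muphi mG G0.
have := ge0_integral_pushforward mphi mu measurableT mG (fun y _ => G0 y).
rewrite preimage_setT => <-; apply: eq_measure_integral => A mA _.
exact: muphi.
Qed.

Lemma ge0_integral_translation (c : V) (G : V -> \bar R) :
  measurable_fun setT G -> (forall x, 0 <= G x) ->
  \int[mu]_x G (x + c)%R = \int[mu]_x G x.
Proof.
apply: ge0_integral_preserving; first exact: measurable_rVD.
by move=> A mA; exact: lebesgue_rV_translation.
Qed.

Lemma lebesgue_rV_eball (c : V) (r : R) : mu (eball c r) = mu (eball 0%R r).
Proof.
rewrite -(@lebesgue_rV_translation _ _ c (eball c r)); last exact: measurable_eball.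
congr (mu _); apply/seteqP; split => x;
by rewrite /eball /= subr0 addrK.
Qed.

Lemma measurable_cube (I : interval R) :
  measurable [set x : V | forall i, [set` I] (x ord0 i)].
Proof.
rewrite (_ : mkset _ = \big[setI/setT]_(i < d)
      ((fun x : V => x ord0 i) @^-1` [set` I])); last first.
  rewrite -bigcap_seq; apply/seteqP; split=> x /= Ax i; first by move=> _; exact: Ax.
  by apply: Ax => /=; rewrite mem_index_enum.
apply: bigsetI_measurable => i _; rewrite -[X in measurable X]setTI.
exact: measurable_coord_rV.
Qed.

(** The ball contains a cube with half-side r / (d + 1). *)
Lemma lebesgue_rV_eball_gt0 (r : R) : (0 < r)%R -> 0 < mu (eball (0%R : V) r).
Proof.
move=> r0; pose s := (r / d.+1%:R)%R.
have s0 : (0 < s)%R by rewrite divr_gt0.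
have cE := @lebesgue_rV_box R d (fun=> [set` `](-s)%R, s[]) (fun=> measurable_itv _).
apply: (@lt_le_trans _ _ (mu [set x : V | forall i, [set` `](-s)%R, s[] (x ord0 i)])).
  rewrite cE; apply: (@big_ind _ (fun x => 0 < x)) => //.
    by move=> x y; exact: mule_gt0.
  move=> i _; rewrite lebesgue_measure_itv/= lte_fin ifT; last by lra.
  by rewrite -EFinB lte_fin; lra.
apply: le_measure; rewrite ?inE; [exact: measurable_cube|exact: measurable_eball|].
move=> x /= xs; rewrite /eball /= subr0.
rewrite -ltr_sqr ?nnegrE ?enorm_ge0 ?ltW// enorm_sqr.
apply: (@le_lt_trans _ _ (\sum_(i < d) s ^+ 2)%R).
  apply: ler_sum => i _; rewrite -expr2 -[leLHS]real_normK ?num_real//.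
  have xis : (`|x ord0 i| <= s)%R.
    by have := xs i; rewrite in_itv/= -ltr_norml => /ltW.
  by rewrite lerXn2r ?nnegrE ?normr_ge0 ?(ltW s0).
rewrite sumr_const card_ord /s expr_div_n -mulrnAr -mulr_natl.
rewrite -[ltRHS]mulr1 ltr_pM2l ?exprn_gt0// ltr_pdivrMr ?exprn_gt0// mul1r.
by rewrite -natrX ltr_nat expnS expn1 mulSn ltn_addr.
Qed.

Lemma lebesgue_rV_eball_fin (r : R) : mu (eball (0%R : V) r) < +oo.
Proof.
have [r0|r0] := ltP r 0%R.
  rewrite (_ : eball _ _ = set0) ?measure0//; apply/seteqP; split => // x.
  by rewrite /eball /= => /(le_lt_trans (enorm_ge0 _)) /lt_trans /(_ r0); rewrite ltxx.
have cE := @lebesgue_rV_box R d (fun=> [set` `[(-r)%R, r]]) (fun=> measurable_itv _).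
apply: (@le_lt_trans _ _ (mu [set x : V | forall i, [set` `[(-r)%R, r]] (x ord0 i)])).
  apply: le_measure; rewrite ?inE; [exact: measurable_eball|exact: measurable_cube|].
  move=> x; rewrite /eball /= subr0 => xr i; rewrite in_itv/= -ler_norml.
  exact: le_trans (coord_le_enorm x i) (ltW xr).
rewrite cE -ge0_fin_numE; last first.
  by apply: (@big_ind _ (fun x => 0 <= x)) => // x y; exact: mule_ge0.
apply: (@big_ind _ (fun x => x \is a fin_num)) => //.
  by move=> x y; exact: fin_numM.
by move=> i _; rewrite lebesgue_measure_itv/=; case: ifP.
Qed.

(** The preimage of A under T has the measure of A because translation
    invariant measures are proportional, and the factor is read off on the unit
    ball B, which T preserves.  Concretely, compute the integral of
    1_B(x) 1_A(x + T y) over all x and y: translating y gives mu B times the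
    measure of the preimage, and translating x first gives mu B * mu A. *)
Lemma lebesgue_rV_isometry (T : V -> V) (A : set V) : measurable_fun setT T ->
  {morph T : x y / (x - y)%R} -> (forall x, enorm (T x) = enorm x) ->
  (forall y, exists x, T x = y) -> measurable A -> mu (T @^-1` A) = mu A.
Proof.
move=> mT TB Te Ts mA.
have T0 : T 0%R = 0%R by rewrite -{1}(subrr 0%R) TB subrr.
have TN x : (T (- x) = - T x)%R by rewrite -sub0r TB T0 sub0r.
have TD : {morph T : x y / (x + y)%R}.
  by move=> x y; rewrite -{1}(opprK y) TB TN opprK.
pose B : set V := eball 0%R 1%R.
have mB : measurable B by exact: measurable_eball.
pose k x : \bar R := (\1_B x)%:E; pose a x : \bar R := (\1_A x)%:E.
have mk : measurable_fun setT k by apply/measurable_EFinP; exact: measurable_indic.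
have ma : measurable_fun setT a by apply/measurable_EFinP; exact: measurable_indic.
have k0 x : 0 <= k x by rewrite lee_fin.
have a0 x : 0 <= a x by rewrite lee_fin.
have kE : \int[mu]_x k x = mu B by rewrite integral_indic// setIT.
have aE : \int[mu]_x a x = mu A by rewrite integral_indic// setIT.
have kk x y : k (x - T y)%R = k (y - sval (cid (Ts x)))%R.
  rewrite -{1}(svalP (cid (Ts x))) -TB /k /B; congr ((_ : R)%:E).
  rewrite !indicE; congr ((_ : bool)%:R); apply/idP/idP; rewrite !inE /eball/= !subr0;
  by rewrite Te enorm_distC.
have TaE : \int[mu]_x a (T x) = mu (T @^-1` A).
  rewrite (_ : (fun x => a (T x)) = (fun x => (\1_(T @^-1` A) x)%:E)).
    rewrite integral_indic// ?setIT//.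
    by rewrite -[X in measurable X]setTI; exact: mT.
  by apply/funext => x.
have mF : measurable_fun setT (fun p : V * V => k p.1 * a (p.1 + T p.2)%R).
  apply: emeasurable_funM; first exact: measurableT_comp mk measurable_fst.
  apply: measurableT_comp ma _; apply: measurable_rVD => //.
  exact: measurableT_comp mT measurable_snd.
have mG : measurable_fun setT (fun p : V * V => k (p.1 - T p.2)%R * a p.1).
  apply: emeasurable_funM; last exact: measurableT_comp ma measurable_fst.
  apply: measurableT_comp mk _; apply: measurable_rVD => //; apply: measurable_rVN.
  exact: measurableT_comp mT measurable_snd.
have E : mu B * mu (T @^-1` A) = mu B * mu A.
  rewrite -{1}kE -TaE -ge0_integralZr//; last exact: integral_ge0.
  transitivity (\int[mu]_x \int[mu]_y (k x * a (x + T y)%R)).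
    apply: eq_integral => x _; rewrite -ge0_integralZl_EFin//; last first.
      exact: measurableT_comp.
    have [c <-] := Ts x; under [RHS]eq_integral do rewrite -TD addrC.
    apply/esym/(@ge0_integral_translation c (fun y => k (T c) * a (T y))).
      apply: emeasurable_funM => //; exact: measurableT_comp.
    by move=> y; exact: mule_ge0.
  rewrite (fubini_tonelli (fun p : V * V => k p.1 * a (p.1 + T p.2)%R))//; last first.
    by move=> p; exact: mule_ge0.
  transitivity (\int[mu]_y \int[mu]_x (k (x - T y)%R * a x)).
    apply: eq_integral => y _.
    rewrite -(@ge0_integral_translation (T y) (fun x => k (x - T y)%R * a x)).
    - by apply: eq_integral => x _ /=; rewrite addrK.
    - apply: emeasurable_funM => //; apply: measurableT_comp mk _.
      exact: measurable_rVD.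
    - by move=> x; exact: mule_ge0.
  rewrite -(fubini_tonelli (fun p : V * V => k (p.1 - T p.2)%R * a p.1))//; last first.
    by move=> p; exact: mule_ge0.
  rewrite -aE -ge0_integralZl//.
  apply: eq_integral => x _ /=; rewrite ge0_integralZr//; last first.
    apply: measurableT_comp mk _; apply: measurable_rVD => //.
    exact: measurable_rVN.
  congr (_ * _); under eq_integral do rewrite kk.
  rewrite -kE; apply: ge0_integral_translation => //.
have B0 : 0 < mu B by exact: lebesgue_rV_eball_gt0.
have Bfin : mu B \is a fin_num by rewrite ge0_fin_numE// lebesgue_rV_eball_fin.
exact: pmule_inj Bfin B0 E.
Qed.

Lemma ge0_integral_bisect_reflection (x y : V) (G : V -> \bar R) : x != y ->
  measurable_fun setT G -> (forall z, 0 <= G z) ->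
  \int[mu]_z G (bisect_reflection x y z) = \int[mu]_z G z.
Proof.
move=> xy mG G0; have w0 : (x - y != 0)%R by rewrite subr_eq0.
pose H z := G (reflection (x - y) z + y)%R.
have mH : measurable_fun setT H.
  by apply: measurableT_comp mG _; apply: measurable_rVD => //; exact: measurable_reflection.
rewrite (@ge0_integral_translation (- x)%R H)//; last by move=> z; exact: G0.
rewrite -[RHS](@ge0_integral_translation y)//.
rewrite (@ge0_integral_preserving (reflection (x - y)) (fun z => G (z + y)%R))//.
- exact: measurable_reflection.
- move=> A mA; apply: lebesgue_rV_isometry => //.
  + exact: measurable_reflection.
  + exact: reflectionB.
  + by move=> z; exact: enorm_reflection.
  + by move=> z; exists (reflection (x - y) z); exact: reflectionK.
- by apply: measurableT_comp mG _; exact: measurable_rVD.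
Qed.

End lebesgue_rV_integral.

(** * Convolution of radially decreasing functions *)

(** This is (a - b) * (c - e) >= 0, written without differences because the
    entries may be infinite. *)
Lemma rearrangement_ereal (R : realType) (a b c e : \bar R) :
  (0 <= b -> b <= a -> 0 <= e -> e <= c -> a * e + b * c <= a * c + b * e)%E.
Proof.
move=> b0 ba e0 ec.
have a0 := le_trans b0 ba; have c0 := le_trans e0 ec.
have big (p q : \bar R) : (0 <= q -> p = +oo -> q = 0 \/ p * q = +oo)%E.
  move=> q0 ->; have [->|qn0] := eqVneq q 0%E; first by left.
  by right; rewrite gt0_mulye// lt0e qn0.
have [aoo|afin] := eqVneq a +oo%E.
  have [cE|acoo] := big _ _ c0 aoo.
    suff -> : e = c by [].
    by apply/le_anti; rewrite ec cE e0.
  by rewrite acoo addye ?leey// gt_eqF// (lt_le_trans _ (mule_ge0 b0 e0)).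
have [coo|cfin] := eqVneq c +oo%E.
  have [aE|acoo] := big _ _ a0 coo.
    suff -> : b = a by rewrite addeC.
    by apply/le_anti; rewrite ba aE b0.
  rewrite muleC in acoo; rewrite acoo addye ?leey//.
  by rewrite gt_eqF// (lt_le_trans _ (mule_ge0 b0 e0)).
have fin (p q : \bar R) : (0 <= p -> p <= q -> q != +oo -> p \is a fin_num)%E.
  by move=> p0 pq qoo; rewrite ge0_fin_numE// (le_lt_trans pq)// lt_neqAle qoo leey.
move: (fin _ _ a0 (lexx _) afin) (fin _ _ b0 ba afin).
move: (fin _ _ c0 (lexx _) cfin) (fin _ _ e0 ec cfin).
case: a b c e b0 ba e0 ec {a0 c0 afin cfin} => [a||] [b||] [c||] [e||] //.
rewrite -!EFinM -!EFinD !lee_fin => b0 ba e0 ec _ _ _ _; nra.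
Qed.

Section convolution.
Context {R : realType} {d : nat}.
Local Notation V := 'rV[R]_d.
Local Notation mu := (lebesgue_rV d).
Local Open Scope ereal_scope.
Implicit Types (f u v : V -> \bar R) (x y z : V).

Definition convol f u x : \bar R := \int[mu]_y (f (x - y)%R * u y).

(** Radial and decreasing in one condition, since points of equal norm may be
    compared both ways. *)
Definition norm_decreasing u := forall x y, (enorm x <= enorm y)%R -> u y <= u x.

Lemma norm_decreasing_even u x : norm_decreasing u -> u (- x)%R = u x.
Proof. by move=> du; apply/le_anti; rewrite !du ?enormN. Qed.

Section convolution_theory.
Variables f u : V -> \bar R.
Hypotheses (mf : measurable_fun setT f) (f0 : forall x, 0 <= f x).
Hypotheses (meas_u : measurable_fun setT u) (u0 : forall x, 0 <= u x).
Hypothesis df : norm_decreasing f.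

Lemma measurable_shift x : measurable_fun setT (fun y => f (x - y)%R).
Proof.
by apply: measurableT_comp mf _; apply: measurable_rVD => //; exact: measurable_rVN.
Qed.

Lemma integral_shift x : \int[mu]_y f (x - y)%R = \int[mu]_y f y.
Proof.
rewrite -(@ge0_integral_translation _ _ (- x)%R f)//.
apply: eq_integral => y _; rewrite -(norm_decreasing_even _ df).
by rewrite opprB.
Qed.

Lemma measurable_conv_integrand :
  measurable_fun setT (fun p : V * V => f (p.1 - p.2)%R * u p.2).
Proof.
apply: emeasurable_funM; last exact: measurableT_comp meas_u measurable_snd.
apply: measurableT_comp mf _; apply: measurable_rVD => //.
exact: measurable_rVN.
Qed.

Lemma measurable_conv_integrandx x : measurable_fun setT (fun y => f (x - y)%R * u y).
Proof. exact: emeasurable_funM (measurable_shift x) meas_u. Qed.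

Lemma conv_ge0 x : 0 <= convol f u x.
Proof. by apply: integral_ge0 => y _; exact: mule_ge0. Qed.

Lemma measurable_conv : measurable_fun setT (convol f u).
Proof.
apply: (measurable_fun_fubini_tonelli_F (m2 := mu)
  (fun p : V * V => f (p.1 - p.2)%R * u p.2)).
  exact: measurable_conv_integrand.
by move=> p; exact: mule_ge0.
Qed.

Lemma integral_conv :
  \int[mu]_x convol f u x = \int[mu]_x f x * \int[mu]_x u x.
Proof.
rewrite /convol (fubini_tonelli (fun p : V * V => f (p.1 - p.2)%R * u p.2))//=; last 2 first.
- exact: measurable_conv_integrand.
- by move=> p; exact: mule_ge0.
rewrite -ge0_integralZl//; last exact: integral_ge0.
apply: eq_integral => y _ /=.
have mfy : measurable_fun setT (fun x => f (x - y)%R).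
  by apply: measurableT_comp mf _; exact: measurable_rVD.
rewrite ge0_integralZr//; congr (_ * _).
exact: (@ge0_integral_translation _ _ (- y)%R f).
Qed.

(** Let phi t z = f (t - z) u z and let s exchange x and y.  Then
    phi y z + phi y (s z) <= phi x z + phi x (s z) for every z, since
    |x - s z| = |y - z| and |y - s z| = |x - z| turn it into a rearrangement
    inequality; and both sides integrate to twice a convolution. *)
Lemma convol_norm_decreasing : norm_decreasing u -> norm_decreasing (convol f u).
Proof.
move=> du x y xy; have [<-//|neq] := eqVneq x y.
pose s := bisect_reflection x y.
pose phi t z := f (t - z)%R * u z.
have phi0 t z : 0 <= phi t z by exact: mule_ge0.
have mphi t : measurable_fun setT (phi t) by exact: measurable_conv_integrandx.
have ms : measurable_fun setT s.
  apply: measurable_rVD => //; apply: measurableT_comp; first exact: measurable_reflection.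
  exact: measurable_rVD.
have mphis t : measurable_fun setT (fun z => phi t (s z)) by exact: measurableT_comp.
have dbl t : \int[mu]_z (phi t z + phi t (s z)) = convol f u t + convol f u t.
  rewrite ge0_integralD//; congr (_ + _).
  exact: ge0_integral_bisect_reflection.
have feq p q : enorm p = enorm q -> f p = f q.
  by move=> pq; apply/le_anti; rewrite !df ?pq.
have dblle : convol f u y + convol f u y <= convol f u x + convol f u x.
  (* compare the integrands averaged over z and its mirror image *)
  rewrite -2!dbl; apply: ge0_le_integral => //.
  - by move=> z _; exact: adde_ge0.
  - exact: emeasurable_funD.
  - exact: emeasurable_funD.
  move=> z _; rewrite /phi.
  rewrite (feq _ _ (enorm_bisect_swap z neq)) (feq _ _ (enorm_bisect_swapr z neq)).
  have [xz|/ltW yz] := leP (enorm (x - z)) (enorm (y - z)).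
    rewrite addeC; apply: rearrangement_ereal => //; first exact: df.
    by apply: du; exact: enorm_le_bisect.
  rewrite [leRHS]addeC; apply: rearrangement_ereal => //; first exact: df.
  apply: du; rewrite -{2}(bisect_reflectionK z neq); apply: enorm_le_bisect => //.
  by rewrite (enorm_bisect_swap z neq) (enorm_bisect_swapr z neq).
by move: dblle; rewrite -!mule2n -!mule_natl lee_pmul2l.
Qed.

End convolution_theory.

(** Off S the integrand is at most a f (x - y) + b u y. *)
Lemma convol_le_split f u x (a b : R) (S : set V) :
  measurable_fun setT f -> (forall x, 0 <= f x) -> norm_decreasing f ->
  measurable_fun setT u -> (forall x, 0 <= u x) ->
  measurable S -> (0 <= a)%R -> (0 <= b)%R ->
  (forall y, ~ S y -> f (x - y)%R <= b%:E \/ u y <= a%:E) ->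
  convol f u x <= a%:E * \int[mu]_y f y + b%:E * \int[mu]_y u y +
    \int[mu]_(y in S) (f (x - y)%R * u y).
Proof.
move=> mf f0 df meas_u u0 mS a0 b0 H.
have mfx := measurable_shift mf x.
rewrite -(integral_shift mf f0 df x) -!ge0_integralZl_EFin// (integral_mkcond S).
set w := _ \_ S.
have mw : measurable_fun setT w.
  apply/(measurable_restrictT _ _).1 => //; apply: measurable_funTS.
  exact: measurable_conv_integrandx.
have w0 y : 0 <= w y by apply: erestrict_ge0 => z _; exact: mule_ge0.
have ma : measurable_fun setT (fun y => a%:E * f (x - y)%R) by exact: measurable_funeM.
have mb : measurable_fun setT (fun y => b%:E * u y) by exact: measurable_funeM.
rewrite -ge0_integralD//; [|by move=> y _; exact: mule_ge0..].
rewrite -ge0_integralD//; last 2 first.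
  by move=> y _; apply: adde_ge0; exact: mule_ge0.
  exact: emeasurable_funD.
apply: ge0_le_integral => //.
- by move=> y _; exact: mule_ge0.
- exact: measurable_conv_integrandx.
- by apply: emeasurable_funD => //; exact: emeasurable_funD.
move=> y _; rewrite /w patchE; case: ifPn => [_|yS].
  by rewrite leeDr// adde_ge0// mule_ge0.
rewrite adde0; have [|fb|ua] := H y; first by move=> Sy; rewrite mem_set in yS.
- by rewrite (le_trans (lee_wpmul2r (u0 y) fb))// leeDr// mule_ge0.
- by rewrite muleC (le_trans (lee_wpmul2r (f0 _) ua))// leeDl// mule_ge0.
Qed.

End convolution.

(** * Convolution powers of f *)

Section assumption_A_theory.
Context {R : realType} {d : nat} (hd : (1 <= d)%N).
Local Notation V := 'rV[R]_d.
Local Notation mu := (lebesgue_rV d).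
Local Open Scope ereal_scope.
Variables (f : V -> \bar R) (C1 C2 : R).
Hypothesis hA : assumption_A f C1 C2.
Local Notation U n := (conv_pow f n.+1).
Local Notation L := (L1norm f).

Lemma enorm_e1 : enorm (e1 d : V) = 1%R.
Proof.
rewrite enormE /dotv (bigD1 (Ordinal hd))//= mxE eqxx mulr1 big1 ?addr0 ?sqrtr1//.
by move=> i; rewrite mxE -val_eqE /= => /negbTE ->; rewrite mulr0.
Qed.

Lemma enorm_rescale (s : R) (x : V) : (0 <= s)%R -> (0 < enorm x)%R ->
  enorm ((s / enorm x) *: x)%R = s.
Proof.
move=> s0 x0; rewrite enormZ ger0_norm ?divr_ge0 ?enorm_ge0// divfK//.
by rewrite gt_eqF.
Qed.

Lemma f_gt0 x : 0 < f x. Proof. exact: (A_gt0 hA). Qed.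

Lemma f_ge0 x : 0 <= f x. Proof. exact/ltW/f_gt0. Qed.

Lemma measurable_f : measurable_fun setT f.
Proof. by have [_ /integrableP[]] := A_density hA. Qed.

Lemma f_norm_decreasing : norm_decreasing f.
Proof.
have [F [dF fF]] := A_radial_decreasing hA => x y xy.
by rewrite !fF dF// enorm_ge0.
Qed.

Lemma L1norm_ge0 : (0 <= L)%R.
Proof. by rewrite /L1norm fine_ge0// Lnorm1 integral_ge0. Qed.

Lemma integral_f : \int[mu]_x f x = L%:E.
Proof.
have abs_f : \int[mu]_x `|f x| = \int[mu]_x f x.
  by apply: eq_integral => x _; rewrite gee0_abs ?f_ge0.
rewrite /L1norm Lnorm1 abs_f fineK// ge0_fin_numE.
  by rewrite -abs_f; have [_ /integrableP[]] := A_density hA.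
by apply: integral_ge0 => x _; exact: f_ge0.
Qed.

(** Otherwise f would be infinite on a ball, which has positive measure. *)
Lemma f_fin_num x : x != 0%R -> f x \is a fin_num.
Proof.
move=> x0; rewrite ge0_fin_numE ?f_ge0// ltNge leye_eq; apply/negP => /eqP fx.
have xn0 : (0 < enorm x)%R by rewrite lt0r enorm_eq0 x0 enorm_ge0.
pose B : set V := eball 0%R (enorm x).
have mB : measurable B by exact: measurable_eball.
have fB y : B y -> f y = +oo.
  rewrite /B /eball/= subr0 => yx; apply/eqP; rewrite -leye_eq -fx.
  exact/f_norm_decreasing/ltW.
have : \int[mu]_(y in B) f y <= \int[mu]_y f y.
  apply: ge0_subset_integral => //; first exact: measurable_f.
  by move=> y _; exact: f_ge0.
rewrite (eq_integral (cst +oo)); last by move=> y; rewrite inE => /fB.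
by rewrite integral_cst// gt0_mulye ?integral_f ?lebesgue_rV_eball_gt0.
Qed.

Lemma conv_powS n : U n.+1 = convol f (U n). Proof. by []. Qed.

Lemma conv_pow_ge0 n x : 0 <= U n x.
Proof.
elim: n x => [|n IH] x; first exact: f_ge0.
by apply: conv_ge0 => //; exact: f_ge0.
Qed.

Lemma measurable_conv_pow n : measurable_fun setT (U n).
Proof.
elim: n => [|n IH]; first exact: measurable_f.
apply: measurable_conv => //; [exact: measurable_f|exact: f_ge0|].
exact: conv_pow_ge0.
Qed.

Lemma conv_pow_norm_decreasing n : norm_decreasing (U n).
Proof.
elim: n => [|n IH]; first exact: f_norm_decreasing.
apply: convol_norm_decreasing => //; [exact: measurable_f|exact: f_ge0|..].
- exact: measurable_conv_pow.
- exact: conv_pow_ge0.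
- exact: f_norm_decreasing.
Qed.

Lemma integral_conv_pow n : \int[mu]_x U n x = (L ^+ n.+1)%:E.
Proof.
elim: n => [|n IH]; first by rewrite expr1 integral_f.
rewrite integral_conv ?IH ?integral_f -?EFinM ?exprS//.
- exact: measurable_f.
- exact: f_ge0.
- exact: measurable_conv_pow.
- exact: conv_pow_ge0.
Qed.

Lemma conv_pow_le_split n x (a b : R) (S : set V) :
  measurable S -> (0 <= a)%R -> (0 <= b)%R ->
  (forall y, ~ S y -> f (x - y)%R <= b%:E \/ U n y <= a%:E) ->
  U n.+1 x <= (a * L + b * L ^+ n.+1)%:E +
    \int[mu]_(y in S) (f (x - y)%R * U n y).
Proof.
move=> mS a0 b0 H; rewrite conv_powS.
apply: (le_trans (convol_le_split (x := x) (S := S) (a := a) (b := b) _ _ _ _ _ _ _ _ _)) => //.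
- exact: measurable_f.
- exact: f_ge0.
- exact: f_norm_decreasing.
- exact: measurable_conv_pow.
- exact: conv_pow_ge0.
- by rewrite integral_f integral_conv_pow EFinD !EFinM.
Qed.

Lemma f_half x : (enorm x <= 2)%R -> f (2^-1 *: x)%R <= C2%:E * f x.
Proof.
move=> x2; have := A_C2 hA (x := (2^-1 *: x)%R); rewrite scalerA divff// scale1r.
apply; rewrite enormZ ger0_norm ?invr_ge0//; lra.
Qed.

(** Assumption (b), iterated along the ray through x. *)
Lemma f_shift x y (k : nat) : (k%:R + 1 <= enorm x)%R ->
  (enorm x - k%:R <= enorm y)%R -> f y <= (C1 ^+ k)%:E * f x.
Proof.
have C11 := A_C1_ge1 hA.
elim: k x y => [|k IH] x y.
  by rewrite subr0 expr0 mul1e => _; exact: f_norm_decreasing.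
rewrite -natr1 => kx xy.
have k0 : (0 <= k%:R :> R)%R by [].
have x0 : (0 < enorm x)%R by lra.
pose z := (((enorm x - 1) / enorm x) *: x)%R.
have ez : enorm z = (enorm x - 1)%R by rewrite enorm_rescale//; lra.
apply: (@le_trans _ _ ((C1 ^+ k)%:E * f z)).
  apply: IH; rewrite ez; lra.
rewrite exprSr EFinM -muleA; apply: lee_wpmul2l; first by rewrite lee_fin exprn_ge0//; lra.
apply: (A_C1 hA); rewrite ez; lra.
Qed.

(** By induction, splitting with S empty: either x - y or y has norm at least
    |x| / 2, and assumption (c) bounds f (x / 2) by C2 f x. *)
Lemma conv_pow_le_near n x : (0 < enorm x)%R -> (enorm x <= 2)%R ->
  U n x <= (n.+1%:R * (C2 * L) ^+ n)%:E * f x.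
Proof.
have C21 := A_C2_ge1 hA; have L0 := L1norm_ge0.
elim: n x => [|n IH] x x0 x2; first by rewrite expr0 mulr1 mul1e.
have xn0 : x != 0%R by rewrite -enorm_eq0 gt_eqF.
pose z := (2^-1 *: x)%R.
have ez : enorm z = (2^-1 * enorm x)%R by rewrite enormZ ger0_norm// invr_ge0.
have fx := f_fin_num xn0; have fx0 := f_ge0 x.
have fz : f z <= (C2 * fine (f x))%:E by rewrite EFinM fineK// f_half.
have fx0' : (0 <= fine (f x))%R by rewrite fine_ge0.
pose k := (n.+1%:R * (C2 * L) ^+ n)%R.
have k0 : (0 <= k)%R by rewrite mulr_ge0// exprn_ge0// mulr_ge0//; lra.
have Uz : U n z <= (k * (C2 * fine (f x)))%:E.
  apply: (le_trans (IH z _ _)); rewrite ?ez; [lra|lra|].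
  by rewrite [leRHS]EFinM; apply: lee_wpmul2l.
have C20 : (0 <= C2)%R by lra.
have := @conv_pow_le_split n x (k * (C2 * fine (f x))) (C2 * fine (f x)) set0
  measurable0 _ _ _; rewrite integral_set0 adde0 => H.
apply: (le_trans (H _ _ _)).
- by rewrite mulr_ge0// mulr_ge0.
- by rewrite mulr_ge0.
- move=> y _; have [xy|xy] := leP (enorm z) (enorm (x - y)).
    by left; apply: le_trans fz; exact: f_norm_decreasing.
  right; apply: le_trans Uz; apply: conv_pow_norm_decreasing.
  have := enormD (x - y) y; rewrite subrK; move: xy; rewrite ez; lra.
rewrite -[in leRHS](fineK fx) -EFinM lee_fin /k.
have LC : (C2 * L ^+ n.+1 <= (C2 * L) ^+ n.+1)%R.
  rewrite exprMn ler_wpM2r ?exprn_ge0// exprS ler_peMr ?exprn_ege1//.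
have := ler_wpM2r fx0' LC; rewrite !exprS.
rewrite -[n.+2%:R]natr1.
set q := ((C2 * L) ^+ n)%R; set p := (L ^+ n)%R; set w := fine (f x); set m : R := n.+1%:R.
lra.
Qed.

(** Shrink x to norm at most 2, where [conv_pow_le_near] applies. *)
Lemma conv_pow_fin_num n x : x != 0%R -> U n x \is a fin_num.
Proof.
move=> x0; have xn0 : (0 < enorm x)%R by rewrite lt0r enorm_eq0 x0 enorm_ge0.
(* the radius min(2, |x|) keeps z nonzero with norm at most 2 *)
pose m : R := Num.min (2 : R)%R (enorm x).
have m0 : (0 < m)%R by rewrite lt_min ltr0n.
pose z := ((m / enorm x) *: x)%R.
have ez : enorm z = m by rewrite enorm_rescale// ltW.
have zn0 : z != 0%R by rewrite -enorm_eq0 ez gt_eqF.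
rewrite ge0_fin_numE ?conv_pow_ge0//.
apply: (@le_lt_trans _ _ (U n z)).
  by apply: conv_pow_norm_decreasing; rewrite ez ge_min lexx orbT.
apply: le_lt_trans (conv_pow_le_near _ _ _) _; rewrite ?ez// ?ge_min ?lexx//.
by rewrite -(fineK (f_fin_num zn0)) -EFinM ltry.
Qed.

Local Notation M1 := (fine (f (e1 d)) * fine (mu (eball (0%R : V) 2^-1)))%R.
Local Notation M2 := (Num.max C1 C2 * L)%R.

Lemma M1_gt0 : (0 < M1)%R.
Proof.
rewrite mulr_gt0// fine_gt0//.
  by rewrite f_gt0 -ge0_fin_numE ?f_ge0// f_fin_num// -enorm_eq0 enorm_e1 oner_eq0.
by rewrite lebesgue_rV_eball_gt0//= lebesgue_rV_eball_fin.
Qed.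

(** On the ball of radius 1/2 around c = (1 - 1 / (2 |x|)) x one has
    |x - y| <= 1 and |y| <= |x|, hence f (x - y) >= f e1 and U n y >= U n x. *)
Lemma conv_pow_ge n x : (1 <= enorm x)%R -> (M1 ^+ n)%:E * f x <= U n x.
Proof.
move=> x1; elim: n => [|n IH]; first by rewrite expr0 mul1e.
pose c := ((1 - (2 * enorm x)^-1) *: x)%R.
have x0 : (0 < enorm x)%R by lra.
have x2 : (0 < (2 * enorm x)^-1 <= 2^-1)%R.
  rewrite invr_gt0 mulr_gt0//= lef_pV2 ?posrE ?mulr_gt0//; lra.
have ec : enorm c = (enorm x - 2^-1)%R.
  rewrite enormZ ger0_norm; last by lra.
  by rewrite mulrBl mul1r invfM divfK// gt_eqF.
have exc : enorm (x - c) = 2^-1%R.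
  have -> : (x - c = (2 * enorm x)^-1 *: x)%R.
    by rewrite /c scalerBl scale1r opprB addrCA subrr addr0.
  by rewrite enormZ ger0_norm ?invfM ?divfK ?gt_eqF//; lra.
pose B : set V := eball c 2^-1.
have mB : measurable B by exact: measurable_eball.
have e1n0 : e1 d != 0%R :> V by rewrite -enorm_eq0 enorm_e1 oner_eq0.
have xn0 : x != 0%R by rewrite -enorm_eq0 gt_eqF.
have muB : mu B = (fine (mu (eball (0%R : V) 2^-1)))%:E.
  by rewrite lebesgue_rV_eball fineK// ge0_fin_numE// lebesgue_rV_eball_fin.
have : \int[mu]_(y in B) (f (e1 d) * U n x) <= U n.+1 x.
  apply: (@le_trans _ _ (\int[mu]_(y in B) (f (x - y)%R * U n y))).
    apply: ge0_le_integral => //.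
    - by move=> y _; rewrite mule_ge0 ?f_ge0 ?conv_pow_ge0.
    - apply: measurable_funTS; apply: measurable_conv_integrandx.
        exact: measurable_f.
      exact: measurable_conv_pow.
    move=> y; rewrite /B /eball /= => yc.
    apply: lee_pmul; rewrite ?f_ge0 ?conv_pow_ge0//.
      apply: f_norm_decreasing; rewrite enorm_e1.
      have := enormD (x - c) (c - y); rewrite addrA subrK exc (enorm_distC c y); lra.
    apply: conv_pow_norm_decreasing.
    have := enormD (y - c) c; rewrite subrK ec; lra.
  apply: ge0_subset_integral => //.
    apply: measurable_conv_integrandx; first exact: measurable_f.
    exact: measurable_conv_pow.
  by move=> y _; rewrite mule_ge0 ?f_ge0 ?conv_pow_ge0.
have -> : \int[mu]_(y in B) (f (e1 d) * U n x) = M1%:E * U n x.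
  transitivity (f (e1 d) * U n x * mu B); first exact: integral_cst.
  by rewrite muB muleAC [in RHS]EFinM (fineK (f_fin_num e1n0)).
apply: le_trans; rewrite exprS EFinM -muleA lee_wpmul2l// lee_fin ltW//.
exact: M1_gt0.
Qed.

Lemma conv_pow_gt0 n x : (1 <= enorm x)%R -> 0 < U n x.
Proof.
move=> x1; apply: lt_le_trans (conv_pow_ge n x1).
by rewrite mule_gt0 ?f_gt0// lte_fin exprn_gt0// M1_gt0.
Qed.

End assumption_A_theory.

(** * The compound Poisson series *)

Section exponential_series.
Context {R : realType}.
Local Open Scope ereal_scope.

Lemma nneseries_expR (t : R) : (0 <= t)%R ->
  \sum_(0 <= n <oo) (t ^+ n / n`!%:R)%:E = (expR t)%:E.
Proof.
move=> t0; rewrite expRE -EFin_lim; last first.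
  rewrite /pseries/=; under eq_fun do rewrite mulrC.
  exact: is_cvg_series_exp_coeff.
apply/congr_lim/funext => n/=; rewrite /pseries/= /series/= -sumEFin//.
by under eq_bigr do rewrite mulrC.
Qed.

(** The factor n cancels against n!, which leaves the exponential series. *)
Lemma nneseries_poisson (l M : R) : (0 <= l)%R -> (0 <= M)%R ->
  \sum_(1 <= n <oo) (l ^+ n / n`!%:R * (n%:R * M ^+ n.-1))%:E =
  (l * expR (M * l))%:E.
Proof.
move=> l0 M0.
rewrite -(@nneseries_addn _ (fun n => (l ^+ n / n`!%:R * (n%:R * M ^+ n.-1))%:E)); last first.
  by move=> n; rewrite lee_fin !mulr_ge0 ?exprn_ge0// invr_ge0.
rewrite EFinM -nneseries_expR ?mulr_ge0// -nneseriesZl; last first.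
  by move=> n _; rewrite lee_fin mulr_ge0 ?exprn_ge0 ?mulr_ge0// invr_ge0.
apply: eq_eseriesr => n _; rewrite -EFinM addn1/= factS natrM exprS exprMn; congr EFin.
field.
by rewrite addrC natr1 !pnatr_eq0 -!lt0n fact_gt0.
Qed.

End exponential_series.

(** * The numerators of h_n and g_n, and the upper bounds *)

Section numerators.
Context {R : realType} {d : nat}.
Local Notation V := 'rV[R]_d.
Local Notation mu := (lebesgue_rV d).
Local Open Scope ereal_scope.
Variables (f : V -> \bar R) (C1 C2 : R).
Hypothesis hA : assumption_A f C1 C2.
Local Notation U n := (conv_pow f n.+1).
Local Notation L := (L1norm f).
Implicit Types (D E : V -> set V).

(** The product of f and [ratio_seq D f n.+1]; its recursion has no
    division, so that Tonelli's theorem gives its measurability. *)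
Fixpoint numerator D n : V -> \bar R :=
  if n is m.+1 then
    fun x => \int[mu]_(y in D x) (f (x - y)%R * numerator D m y)
  else f.

Lemma ratio_seqS D n x : ratio_seq D f n.+2 x =
  (\int[mu]_(y in D x) (f (x - y)%R * f y * ratio_seq D f n.+1 y)) / f x.
Proof. by []. Qed.

Lemma ratio_seq_numerator D n x : D 0%R = set0 ->
  f x * ratio_seq D f n.+1 x = numerator D n x.
Proof.
move=> D0; elim: n x => [|n IH] x; first by rewrite /= mule1.
rewrite ratio_seqS -[RHS]/(\int[mu]_(y in D x) (f (x - y)%R * numerator D n y)).
under eq_integral do rewrite -muleA IH.
have [->|x0] := eqVneq x 0%R; first by rewrite D0 integral_set0 mul0e mule0.
have fx := f_fin_num hA x0.
by rewrite muleCA divee ?mule1// gt_eqF ?(f_gt0 hA).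
Qed.

Lemma ratio_seqE D n x : D 0%R = set0 -> x != 0%R ->
  ratio_seq D f n.+1 x = numerator D n x / f x.
Proof.
move=> D0 x0; rewrite -ratio_seq_numerator// muleAC divee ?mul1e//.
  exact: (f_fin_num hA).
by rewrite gt_eqF ?(f_gt0 hA).
Qed.

Lemma le_integral_shift (A B : set V) (u v : V -> \bar R) x :
  measurable A -> measurable B -> A `<=` B ->
  measurable_fun setT u -> measurable_fun setT v -> (forall y, 0 <= u y) ->
  (forall y, 0 <= v y) -> (forall y, A y -> u y <= v y) ->
  \int[mu]_(y in A) (f (x - y)%R * u y) <= \int[mu]_(y in B) (f (x - y)%R * v y).
Proof.
move=> mA mB AB meas_u mv u0 v0 uv.
have mf := measurable_f hA; have f0 := f_ge0 hA.
apply: (@le_trans _ _ (\int[mu]_(y in A) (f (x - y)%R * v y))).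
  apply: ge0_le_integral => //.
  - by move=> y _; rewrite mule_ge0.
  - by apply: measurable_funTS; exact: measurable_conv_integrandx.
  - by apply: measurable_funTS; exact: measurable_conv_integrandx.
  - by move=> y Ay; rewrite lee_wpmul2l// uv.
apply: ge0_subset_integral => //.
- by apply: measurable_funTS; exact: measurable_conv_integrandx.
- by move=> y _; rewrite mule_ge0.
Qed.

Lemma integral_shift_le_conv_pow (A : set V) n x : measurable A ->
  \int[mu]_(y in A) (f (x - y)%R * U n y) <= U n.+1 x.
Proof.
have mU := measurable_conv_pow hA n; have U0 := conv_pow_ge0 hA n.
by move=> mA; exact: (@le_integral_shift A setT (U n) (U n) x).
Qed.

Section measurable_domain.
Variable D : V -> set V.
Hypothesis mD : measurable [set p : V * V | D p.1 p.2].

Lemma measurable_domain x : measurable (D x).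
Proof.
rewrite (_ : D x = xsection [set p : V * V | D p.1 p.2] x).
  exact: measurable_xsection.
by apply/seteqP; split => y; rewrite xsectionE.
Qed.

Lemma numerator_ge0 n x : 0 <= numerator D n x.
Proof.
elim: n x => [|n IH] x; first exact: (f_ge0 hA).
by apply: integral_ge0 => y _; rewrite mule_ge0// (f_ge0 hA).
Qed.

Lemma measurable_numerator n : measurable_fun setT (numerator D n).
Proof.
elim: n => [|n IH]; first exact: (measurable_f hA).
pose g (p : V * V) := f (p.1 - p.2)%R * numerator D n p.2.
pose h := g \_ [set p : V * V | D p.1 p.2].
have g0 p : 0 <= g p by rewrite mule_ge0 ?(f_ge0 hA) ?numerator_ge0.
have mh : measurable_fun setT h.
  apply/(measurable_restrictT _ _).1 => //; apply: measurable_funTS.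
  exact: (measurable_conv_integrand (measurable_f hA) IH).
rewrite (_ : numerator D n.+1 = (fun x => \int[mu]_y h (x, y))).
  apply: (measurable_fun_fubini_tonelli_F (m2 := mu) h) => //.
  by move=> p; apply: erestrict_ge0.
apply/funext => x /=; rewrite integral_mkcond; apply: eq_integral => y _.
rewrite /h !patchE /g /=; congr (if _ then _ else _).
Qed.

Lemma numerator_le_conv_pow n x : numerator D n x <= U n x.
Proof.
elim: n x => [//|n IH] x; rewrite conv_powS /convol.
have mDx := measurable_domain x.
have mN := measurable_numerator n; have N0 := numerator_ge0 n.
have mU := measurable_conv_pow hA n; have U0 := conv_pow_ge0 hA n.
exact: (@le_integral_shift (D x) setT (numerator D n) (U n) x).
Qed.

End measurable_domain.

Lemma numerator_mono D E n x :
  measurable [set p : V * V | D p.1 p.2] ->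
  measurable [set p : V * V | E p.1 p.2] ->
  (forall x, D x `<=` E x) -> numerator D n x <= numerator E n x.
Proof.
move=> mD mE DE; elim: n x => [//|n IH] x.
have mDx := measurable_domain mD x; have mEx := measurable_domain mE x.
have mN := measurable_numerator mD n; have mN' := measurable_numerator mE n.
have N0 := @numerator_ge0 D n; have N0' := @numerator_ge0 E n.
exact: (@le_integral_shift (D x) (E x) (numerator D n) (numerator E n) x).
Qed.

Lemma measurable_E_set : measurable [set p : V * V | E_set p.1 p.2].
Proof.
apply: measurableI; apply: measurable_set_ltr; apply: measurable_enorm => //.
by apply: measurable_rVD => //; exact: measurable_rVN.
Qed.

Lemma measurable_D_set : measurable [set p : V * V | D_set p.1 p.2].
Proof.
have m1 : measurable_fun setT (fun p : V * V => enorm p.1 - 1)%R.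
  by apply: measurable_funB => //; exact: measurable_enorm.
apply: measurableI; apply: measurable_set_ltr => //; apply: measurable_enorm => //.
by apply: measurable_rVD => //; exact: measurable_rVN.
Qed.

Lemma E_set0 : E_set (0%R : V) = set0.
Proof.
apply/seteqP; split => // y [].
by rewrite enorm0 => /(le_lt_trans (enorm_ge0 _)); rewrite ltxx.
Qed.

Lemma D_set0 : D_set (0%R : V) = set0.
Proof.
by apply/seteqP; split => // y []; rewrite enorm0; have := enorm_ge0 y; lra.
Qed.

Lemma D_set_sub_E_set (x : V) : D_set x `<=` E_set x.
Proof. by move=> y [? ?]; split; lra. Qed.

Local Notation N n := (numerator (@D_set R d) n).

(** Off D(x), either |x - y| >= |x| - 1, where f (x - y) <= C1 f x, or
    |y| >= |x| - 1. *)
Lemma conv_pow_le_D_set n x (a : R) : (2 <= enorm x)%R -> (0 <= a)%R ->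
  (forall y, (enorm x - 1 <= enorm y)%R -> U n y <= a%:E) ->
  U n.+1 x <= (a * L + C1 * fine (f x) * L ^+ n.+1)%:E +
    \int[mu]_(y in D_set x) (f (x - y)%R * U n y).
Proof.
move=> x2 a0 Ua; have C11 := A_C1_ge1 hA.
have xn0 : x != 0%R by rewrite -enorm_eq0 gt_eqF//; lra.
apply: (conv_pow_le_split hA) => //.
- exact: (measurable_domain measurable_D_set).
- by rewrite mulr_ge0 ?fine_ge0 ?(f_ge0 hA)//; lra.
move=> y; have [xy|xy] := leP (enorm x - 1)%R (enorm (x - y)) => Dy.
  left; rewrite EFinM fineK ?(f_fin_num hA)// -[C1]expr1.
  apply: (f_shift hA); rewrite ?mulr1n//; lra.
right; apply: Ua; rewrite leNgt; apply/negP => yx; exact: Dy.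
Qed.

Local Notation M2 := (Num.max C1 C2 * L)%R.

(** For |x| > 2 and y in D(x), |x - y| < |x| - 1 forces |y| > 1, so that the
    induction hypothesis applies to U n y. *)
Lemma conv_pow_le (C : R) n x : (0 < C)%R ->
  (forall x, h_ f 2 x < C%:E) -> (1 <= enorm x)%R ->
  U n x <= (n.+1%:R * (M2 + C) ^+ n)%:E * f x.
Proof.
move=> C0 hC; have L0 := L1norm_ge0 f.
have C11 := A_C1_ge1 hA; have C21 := A_C2_ge1 hA.
have CM1 : (C1 <= Num.max C1 C2)%R by rewrite le_max lexx.
have CM2 : (C2 <= Num.max C1 C2)%R by rewrite le_max lexx orbT.
set M := Num.max C1 C2 in CM1 CM2 *.
have ML0 : (0 <= M * L)%R by rewrite mulr_ge0//; lra.
have x_neq0 (z : V) : (1 <= enorm z)%R -> z != 0%R.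
  by move=> z1; rewrite -enorm_eq0 gt_eqF//; lra.
elim: n x => [|n IH] x x1; first by rewrite expr0 mulr1 mul1e.
have f0 := f_ge0 hA.
have [x2|x2] := leP (enorm x) 2%R.
  apply: (le_trans (conv_pow_le_near hA _ _ _)) => //; first by lra.
  apply: lee_wpmul2r => //; rewrite lee_fin ler_wpM2l//.
  rewrite lerXn2r ?nnegrE ?addr_ge0 ?(ltW C0)// ?mulr_ge0//; first by lra.
  by have := ler_wpM2r L0 CM2; lra.
have fx := f_fin_num hA (x_neq0 _ x1).
have fx0 : (0 <= fine (f x))%R by rewrite fine_ge0.
pose k := (n.+1%:R * (M * L + C) ^+ n)%R.
have k0 : (0 <= k)%R by rewrite mulr_ge0// exprn_ge0// addr_ge0// ltW.
apply: (le_trans (@conv_pow_le_D_set n x (k * (C1 * fine (f x))) _ _ _)).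
- exact: ltW.
- by rewrite mulr_ge0// mulr_ge0//; lra.
- move=> y xy; apply: le_trans (IH y _) _; first by lra.
  rewrite [leRHS]EFinM lee_wpmul2l// EFinM fineK// -[C1]expr1.
  apply: (f_shift hA); rewrite ?mulr1n//; lra.
have DC : \int[mu]_(y in D_set x) (f (x - y)%R * U n y) <= (k * (C * fine (f x)))%:E.
  have mD := measurable_domain measurable_D_set x.
  apply: (@le_trans _ _ (\int[mu]_(y in D_set x) (f (x - y)%R * (k%:E * f y)))).
    apply: le_integral_shift => //.
    - exact: (measurable_conv_pow hA).
    - by apply: measurable_funeM; exact: (measurable_f hA).
    - exact: (conv_pow_ge0 hA).
    - by move=> y; rewrite mule_ge0.
    - move=> y [_ yx]; apply: IH.
      by have := enormD (x - y) y; rewrite subrK; lra.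
  under eq_integral do rewrite muleCA.
  rewrite ge0_integralZl_EFin//; last 2 first.
  - by move=> y _; rewrite mule_ge0.
  - apply: measurable_funTS; apply: measurable_conv_integrandx; exact: (measurable_f hA).
  rewrite [leRHS]EFinM; apply: lee_wpmul2l; first by rewrite lee_fin.
  rewrite -[leLHS]/(N 1 x) -ratio_seq_numerator ?D_set0//.
  rewrite EFinM fineK// muleC lee_wpmul2r//; exact/ltW/hC.
apply: (le_trans (leeD2l _ DC)).
rewrite -[in leRHS](fineK fx) -EFinM -EFinD lee_fin.
have LM : (C1 * L ^+ n.+1 <= (M * L + C) ^+ n.+1)%R.
  apply: (@le_trans _ _ ((M * L) ^+ n.+1)%R).
    rewrite exprMn ler_wpM2r ?exprn_ge0// exprS.
    by apply: le_trans CM1 _; rewrite ler_peMr ?exprn_ege1//; lra.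
  rewrite lerXn2r ?nnegrE ?addr_ge0 ?(ltW C0)//; lra.
have CL : (k * C1 * L <= k * (M * L))%R.
  by rewrite -mulrA ler_wpM2l// ler_wpM2r.
move: (ler_wpM2r fx0 LM) (ler_wpM2r fx0 CL).
rewrite -[n.+2%:R]natr1 [in X in (X * _ <= _)%R]exprS /k.
rewrite !exprS; nra.
Qed.

Lemma poisson_factor (M l : R) x : (0 <= M)%R -> (0 <= l)%R -> x != 0%R ->
  (expR (- l * L))%:E *
    \sum_(1 <= n <oo) ((l ^+ n / n`!%:R * (n%:R * M ^+ n.-1))%:E * f x) =
  (expR ((M - L) * l) * l)%:E * f x.
Proof.
move=> M0 l0 x0; have fx := f_fin_num hA x0.
under eq_eseriesr do rewrite muleC -{1}(fineK fx).
rewrite nneseriesZl ?nneseries_poisson//; last first.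
  by move=> n _; rewrite lee_fin !mulr_ge0 ?exprn_ge0// invr_ge0.
rewrite fineK// muleCA muleC -EFinM; congr (_%:E * _).
by rewrite mulrBl expRD mulNr (mulrC l L); ring.
Qed.

Lemma poisson_density_le (M l : R) x : (0 <= M)%R -> (0 <= l)%R -> x != 0%R ->
  (forall n, U n x <= (n.+1%:R * M ^+ n)%:E * f x) ->
  poisson_density f l x <= (expR ((M - L) * l) * l)%:E * f x.
Proof.
move=> M0 l0 x0 UM; rewrite -poisson_factor//.
apply: lee_wpmul2l; first by rewrite lee_fin expR_ge0.
apply: lee_nneseries => [[|n] // _ _|[|n] _]; rewrite /=.
- by rewrite mule_ge0 ?(conv_pow_ge0 hA)// lee_fin divr_ge0 ?exprn_ge0.
- by rewrite mule0 mul0r mulr0 mul0e.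
- rewrite [in leRHS]EFinM -muleA; apply: lee_wpmul2l; last exact: UM.
  by rewrite lee_fin divr_ge0 ?exprn_ge0.
Qed.

Lemma poisson_density_ge (M l : R) x : (0 <= M)%R -> (0 <= l)%R -> x != 0%R ->
  (forall n, (n.+1%:R * M ^+ n)%:E * f x <= U n x) ->
  (expR ((M - L) * l) * l)%:E * f x <= poisson_density f l x.
Proof.
move=> M0 l0 x0 UM; rewrite -poisson_factor//.
apply: lee_wpmul2l; first by rewrite lee_fin expR_ge0.
apply: lee_nneseries => [[|n] // _ _|[|n] _]; rewrite /=.
- by rewrite mule_ge0 ?(f_ge0 hA)// lee_fin !mulr_ge0 ?exprn_ge0 ?invr_ge0.
- by rewrite mule0 mul0r mulr0 mul0e.
- rewrite [in leLHS]EFinM -muleA; apply: lee_wpmul2l; last exact: UM.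
  by rewrite lee_fin divr_ge0 ?exprn_ge0.
Qed.

End numerators.

(** * Negligibility and equivalence at infinity *)

Section infinity.
Context {R : realType} {d : nat}.
Local Notation V := 'rV[R]_d.
Local Open Scope ereal_scope.
Implicit Types u v w : V -> \bar R.

Lemma near_enorm_ge (r : R) : \forall x \near enorm_infty d, (r <= enorm x)%R.
Proof. by exists r => // x /= /ltW. Qed.

Lemma near_enorm_infty_nat (P : V -> Prop) : (\forall x \near enorm_infty d, P x) ->
  exists k : nat, forall x, (k%:R <= enorm x)%R -> P x.
Proof.
move=> [r _ rP]; exists (Num.truncn r).+1 => x kx; apply: rP => /=.
by apply: lt_le_trans kx; exact: truncnS_gt.
Qed.

(** The relation u = o(v) at infinity, for values that may be infinite. *)
Definition negligible_infty u v :=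
  forall A : R, (0 < A)%R -> \forall x \near enorm_infty d, A%:E * u x <= v x.

Lemma negligible_infty_trans u v w :
  negligible_infty u v -> negligible_infty v w -> negligible_infty u w.
Proof.
move=> uv vw A A0; have := uv _ A0; have := vw 1%R ltr01; apply: filterS2 => x.
by rewrite mul1e => vwx uvx; exact: le_trans uvx vwx.
Qed.

Lemma negligible_infty_cvgy u v :
  (\forall x \near enorm_infty d, 0 < u x /\ u x \is a fin_num) ->
  negligible_infty u v -> v x / u x @[x --> enorm_infty d] --> +oo.
Proof.
move=> u0 uv; apply/cvgeyPge => A.
have A0 : (0 < `|A| + 1)%R by rewrite ltr_wpDl.
move: u0 (uv _ A0); apply: filterS2 => x [ux0 uxfin].
have r0 : (0 < fine (u x))%R by rewrite fine_gt0// ux0 ltey_eq uxfin.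
rewrite -(fineK uxfin) inver gt_eqF// lee_pdivlMr//; apply: le_trans.
rewrite -EFinM lee_fin ler_wpM2r// ?ltW//.
by rewrite (le_lt_trans (ler_norm A))// ltrDl.
Qed.

(** The witness is eps = u / v - 1. *)
Lemma equiv_infty_squeeze u v :
  (\forall x \near enorm_infty d, [/\ 0 < v x, v x \is a fin_num & v x <= u x]) ->
  (forall e : R, (0 < e)%R ->
    \forall x \near enorm_infty d, u x <= (1 + e)%:E * v x) ->
  equiv_infty u v.
Proof.
move=> v0 uv; exists (fun x => fine (u x) / fine (v x) - 1)%R.
  apply/cvgr0Pnorm_le => e e0; move: v0 (uv _ e0); apply: filterS2.
  move=> x [vx0 vxfin vux uvx].
  have r0 : (0 < fine (v x))%R by rewrite fine_gt0// vx0 ltey_eq vxfin.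
  have ux : u x \is a fin_num.
    rewrite ge0_fin_numE ?(le_trans (ltW vx0))//; apply: le_lt_trans uvx _.
    by rewrite -(fineK vxfin) -EFinM ltry.
  move: vux uvx; rewrite -(fineK vxfin) -(fineK ux) -EFinM !lee_fin => vux uvx.
  rewrite ger0_norm; last by rewrite subr_ge0 ler_pdivlMr// mul1r.
  by rewrite lerBlDl ler_pdivrMr.
move: v0 (uv _ ltr01); apply: filterS2.
move=> x [vx0 vxfin vux uvx].
have r0 : (0 < fine (v x))%R by rewrite fine_gt0// vx0 ltey_eq vxfin.
have ux : u x \is a fin_num.
  rewrite ge0_fin_numE ?(le_trans (ltW vx0))//; apply: le_lt_trans uvx _.
  by rewrite -(fineK vxfin) -EFinM ltry.
rewrite -(fineK vxfin) -(fineK ux) -EFinM/=; congr EFin.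
by rewrite addrC subrK mulrC divfK// gt_eqF.
Qed.

End infinity.

(** * Asymptotic comparison of the convolution powers *)

Section asymptotics.
Context {R : realType} {d : nat}.
Local Notation V := 'rV[R]_d.
Local Notation mu := (lebesgue_rV d).
Local Open Scope ereal_scope.
Variables (f : V -> \bar R) (C1 C2 : R).
Hypothesis hA : assumption_A f C1 C2.
Local Notation U n := (conv_pow f n.+1).
Local Notation L := (L1norm f).
Local Notation N n := (numerator f (@D_set R d) n).

Let f0 := f_ge0 hA.
Let U0 := conv_pow_ge0 hA.
Let mf := measurable_f hA.
Let mU := measurable_conv_pow hA.

Lemma enorm_ge1_neq0 (x : V) : (1 <= enorm x)%R -> x != 0%R.
Proof. by move=> x1; rewrite -enorm_eq0 gt_eqF//; lra. Qed.

Lemma f_shift1 x y : (2 <= enorm x)%R -> (enorm x - 1 <= enorm y)%R ->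
  f y <= C1%:E * f x.
Proof.
by move=> x2 xy; rewrite -[C1]expr1; apply: (f_shift hA) => //; rewrite mulr1n; lra.
Qed.

Hypothesis f_negligible : negligible_infty f (U 1).

(** Choose k with 2 A U n y <= U n.+1 y for |y| >= k.  The part of U n.+1 x over
    |y| < k is O(f x), hence at most half of it, and the part over |y| >= k is
    at most U n.+2 x / (2 A). *)
Lemma negligible_conv_powS n :
  negligible_infty (U n) (U n.+1) /\ negligible_infty f (U n.+1).
Proof.
have C11 := A_C1_ge1 hA; have L0 := L1norm_ge0 f.
elim: n => [//|n [IH IHf]].
suff H : negligible_infty (U n.+1) (U n.+2).
  by split => //; exact: negligible_infty_trans IHf H.
move=> A A0.
have A2 : (0 < 2 * A)%R by lra.
have [k kP] := near_enorm_infty_nat (IH _ A2).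
pose c := (C1 ^+ k)%R; pose l := (L ^+ n.+1)%R.
have c0 : (0 <= c)%R by rewrite exprn_ge0//; lra.
have l0 : (0 <= l)%R by rewrite exprn_ge0.
have B0 : (0 < 2 * (c * l) + 1)%R by rewrite ltr_wpDl// !mulr_ge0.
move: (@near_enorm_ge R d (k%:R + 1)%R) (IHf _ B0); apply: filterS2 => x kx fU.
have k0 : (0 <= k%:R :> R)%R by [].
have x0 : x != 0%R by apply: enorm_ge1_neq0; lra.
pose S : set V := ~` eball 0%R k%:R.
have mS : measurable S by apply: measurableC; exact: measurable_eball.
have SE y : S y <-> (k%:R <= enorm y)%R.
  by rewrite /S /eball /= subr0 leNgt; split => /negP.
pose I := \int[mu]_(y in S) (f (x - y)%R * U n y).
have fx := f_fin_num hA x0; have fx0 : (0 <= fine (f x))%R by rewrite fine_ge0.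
have U1 := conv_pow_fin_num hA n.+1 x0.
have U2 := conv_pow_fin_num hA n.+2 x0.
have split1 : U n.+1 x <= (0 * L + (c * fine (f x)) * l)%:E + I.
  apply: (conv_pow_le_split hA) => //; first by rewrite mulr_ge0.
  move=> y /SE /negP; rewrite -ltNge => yk; left.
  rewrite EFinM fineK//; apply: (f_shift hA) => //.
  by have := enormB x y; lra.
have I0 : 0 <= I by apply: integral_ge0 => y _; rewrite mule_ge0.
have IU : I <= U n.+1 x by exact: (integral_shift_le_conv_pow hA).
have Ifin : I \is a fin_num by rewrite ge0_fin_numE// (le_lt_trans IU)// ltey_eq U1.
have I2 : (2 * A)%:E * I <= U n.+2 x.
  have A20 : (0 <= 2 * A)%R by lra.
  rewrite /I -ge0_integralZl_EFin//; last 2 first.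
  - by move=> y _; rewrite mule_ge0.
  - by apply: measurable_funTS; exact: measurable_conv_integrandx.
  under eq_integral do rewrite muleCA.
  apply: le_trans (integral_shift_le_conv_pow hA n.+1 x mS).
  apply: (le_integral_shift hA) => //.
  - by apply: measurable_funeM.
  - by move=> y; rewrite mule_ge0.
  - by move=> y /SE; exact: kP.
move: split1 I2 fU.
rewrite -(fineK U1) -(fineK U2) -(fineK Ifin) -(fineK fx) -?EFinM -?EFinD !lee_fin mul0r add0r.
move: (fine (U n.+1 x)) (fine (U n.+2 x)) (fine I) fx0 => u1 u2 i.
rewrite fineK//.
move: (fine (f x)) => p p0 h1 h2 h3.
have h4 := ler_wpM2l (ltW A0) h1; have h5 := ler_wpM2l (ltW A0) h3.
have h6 : (0 <= A * p)%R by rewrite mulr_ge0// ltW.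
lra.
Qed.

(** By monotonicity it suffices to compare x with the point x' of norm |x| - 1
    on its ray.  Where |x' - z| >= 1, f (x' - z) <= C1 f (x - z); where
    |x' - z| < 1, |z| is at least |x| - 2, and two uses of the induction
    hypothesis bound U n z by K^2 U n x, which is at most K^2 U n.+1 x. *)
Lemma conv_pow_shift n : exists (K : R) (k : nat), [/\ (0 <= K)%R, (2 <= k)%N &
  forall x y, (k%:R <= enorm x)%R -> (enorm x - 1 <= enorm y)%R ->
    U n y <= K%:E * U n x].
Proof.
have C11 := A_C1_ge1 hA; have L0 := L1norm_ge0 f.
elim: n => [|n [K [k [K0 k2 KP]]]].
  exists C1, 2%N; split => //; first by lra.
  by move=> x y; exact: f_shift1.
have [k1 k1P] := near_enorm_infty_nat ((negligible_conv_powS n).1 1%R ltr01).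
exists (K * K * L + C1)%R, (k + k1 + 1)%N; split.
- by rewrite addr_ge0 ?mulr_ge0//; lra.
- by rewrite -addnA (leq_trans k2)// leq_addr.
move=> x y; rewrite !natrD => kx xy.
have k1x : (0 <= k1%:R :> R)%R by [].
have k2' : (2 <= k%:R :> R)%R by rewrite ler_nat.
have xgt0 : (0 < enorm x)%R by lra.
have x0 : x != 0%R by apply: enorm_ge1_neq0; lra.
pose x' := (((enorm x - 1) / enorm x) *: x)%R.
have ex' : enorm x' = (enorm x - 1)%R by rewrite enorm_rescale//; lra.
have xx' : enorm (x - x') = 1%R.
  have -> : (x - x' = (1 / enorm x) *: x)%R.
    rewrite /x' -{1}(scale1r x) -scalerBl; congr (_ *: _)%R.
    by field; rewrite gt_eqF.
  by rewrite enorm_rescale.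
apply: (@le_trans _ _ (U n.+1 x')).
  by apply: (conv_pow_norm_decreasing hA); rewrite ex'.
pose S : set V := ~` eball x' 1.
have mS : measurable S by apply: measurableC; exact: measurable_eball.
have Ux := conv_pow_fin_num hA n x0; have U1x := conv_pow_fin_num hA n.+1 x0.
have Ux0 : (0 <= fine (U n x))%R by rewrite fine_ge0.
have Ux' : U n x' <= (K * fine (U n x))%:E.
  by rewrite EFinM fineK//; apply: KP; rewrite ?ex'; lra.
have split1 : U n.+1 x' <= (K * (K * fine (U n x)) * L + 0 * L ^+ n.+1)%:E +
    \int[mu]_(z in S) (f (x' - z)%R * U n z).
  apply: (conv_pow_le_split hA) => //; first by rewrite !mulr_ge0.
  move=> z; rewrite /S /eball /= => /contrapT zx'; right.
  rewrite EFinM; apply: (@le_trans _ _ (K%:E * U n x')).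
    apply: KP; rewrite ex'; first by lra.
    have := enormB x' (x' - z)%R; rewrite subKr ex' (enorm_distC x' z); lra.
  by apply: lee_wpmul2l.
have I1 : \int[mu]_(z in S) (f (x' - z)%R * U n z) <= C1%:E * U n.+1 x.
  apply: (@le_trans _ _ (\int[mu]_(z in S) (C1%:E * (f (x - z)%R * U n z)))).
    apply: ge0_le_integral => //.
    - by move=> z _; rewrite mule_ge0.
    - by apply: measurable_funTS; exact: measurable_conv_integrandx.
    - apply: measurable_funTS; apply: measurable_funeM.
      exact: measurable_conv_integrandx.
    - move=> z; rewrite /S /eball /= => /negP; rewrite -leNgt enorm_distC => zx'.
      rewrite muleA; apply: lee_wpmul2r; first exact: U0.
      have [le|lt] := leP (enorm (x' - z)) (enorm (x - z)).
        apply: (A_C1 hA) => //.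
        by have := enormD (x - x') (x' - z); rewrite addrA subrK xx'; lra.
      apply: (@le_trans _ _ (f (x - z)%R)).
        by apply: (f_norm_decreasing hA); exact: ltW.
      by rewrite lee_pemull// lee_fin.
  have C10 : (0 <= C1)%R by lra.
  rewrite ge0_integralZl_EFin//; last 2 first.
  - by move=> y' _; rewrite mule_ge0.
  - by apply: measurable_funTS; exact: measurable_conv_integrandx.
  by rewrite lee_wpmul2l//; exact: (integral_shift_le_conv_pow hA).
apply: (le_trans split1); apply: (le_trans (leeD2l _ I1)).
have := k1P x; rewrite mul1e => /(_ ltac:(lra)).
rewrite -(fineK Ux) -(fineK U1x) -!EFinM -EFinD !lee_fin mul0r addr0 => h1.
have KL : (0 <= K * K * L)%R by rewrite !mulr_ge0.
have := ler_wpM2l KL h1; rewrite fineK//; lra.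
Qed.

(** Off the y in D(x) with |y| >= k, either |x - y| >= |x| - (k + 1), where
    f (x - y) = O(f x), or |y| >= |x| - 1, where U n y = O(U n x). *)
Lemma conv_pow_le_numerator n (e : R) : (0 < e)%R ->
  \forall x \near enorm_infty d, U n x <= (1 + e)%:E * N n x.
Proof.
have C11 := A_C1_ge1 hA; have L0 := L1norm_ge0 f.
elim: n e => [|n IH] e e0.
  apply: filterS (@near_enorm_ge R d 0%R) => x _.
  by rewrite lee_pemull// lee_fin; lra.
have e20 : (0 < e / 2)%R by lra.
have [k kP] := near_enorm_infty_nat (IH _ e20).
have [K [k2 [K0 k22 KP]]] := conv_pow_shift n.
(* t solves (1 + e) * (1 - t) = 1 + e / 2 *)
pose t := (e / (2 * (1 + e)))%R.
have t0 : (0 < t)%R by rewrite divr_gt0//; lra.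
pose c := (C1 ^+ k.+1)%R; pose l := (L ^+ n.+1)%R.
have c0 : (0 <= c)%R by rewrite exprn_ge0//; lra.
have l0 : (0 <= l)%R by rewrite exprn_ge0.
have A1 : (0 < 2 * (K * L) / t + 1)%R 
  by rewrite ltr_wpDl//; apply: divr_ge0; [rewrite mulr_ge0// mulr_ge0|exact: ltW].
have A2 : (0 < 2 * (c * l) / t + 1)%R 
  by rewrite ltr_wpDl//; apply: divr_ge0; [rewrite mulr_ge0// mulr_ge0|exact: ltW].
have [UU fU] := negligible_conv_powS n.
move: (@near_enorm_ge R d (k%:R + k2%:R + 2)%R) (UU _ A1) (fU _ A2).
apply: filterS3 => x kx UUx fUx.
have k0 : (0 <= k%:R :> R)%R by [].
have k20 : (0 <= k2%:R :> R)%R by [].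
have x0 : x != 0%R by apply: enorm_ge1_neq0; lra.
have fx := f_fin_num hA x0; have fx0 : (0 <= fine (f x))%R by rewrite fine_ge0.
have Ux := conv_pow_fin_num hA n x0; have U1x := conv_pow_fin_num hA n.+1 x0.
have Ux0 : (0 <= fine (U n x))%R by rewrite fine_ge0.
have mDx := measurable_domain (@measurable_D_set R d) x.
have mN := measurable_numerator hA (@measurable_D_set R d) n.
have N0 m y : 0 <= N m y by exact: (numerator_ge0 hA).
pose S := D_set x `&` ~` eball 0%R k%:R.
have mS : measurable S.
  by apply: measurableI => //; apply: measurableC; exact: measurable_eball.
have split1 : U n.+1 x <= (K * fine (U n x) * L + c * fine (f x) * l)%:E +
    \int[mu]_(y in S) (f (x - y)%R * U n y).
  apply: (conv_pow_le_split hA) => //; rewrite ?mulr_ge0// => y Sy.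
  have [xy|xy] := leP (enorm x - k.+1%:R)%R (enorm (x - y)).
    by left; rewrite EFinM fineK//; apply: (f_shift hA) => //; rewrite -natr1; lra.
  right; rewrite EFinM fineK//; apply: KP; first by lra.
  rewrite leNgt; apply/negP => yx; apply: Sy; split.
    by split => //; move: xy; rewrite -natr1; lra.
  rewrite /eball /= subr0; apply/negP; rewrite -leNgt.
  by have := enormB x (x - y); rewrite subKr; move: xy; rewrite -natr1; lra.
have I1 : \int[mu]_(y in S) (f (x - y)%R * U n y) <= (1 + e / 2)%:E * N n.+1 x.
  have e21 : (0 <= 1 + e / 2)%R by lra.
  apply: (@le_trans _ _ (\int[mu]_(y in D_set x) (f (x - y)%R * ((1 + e / 2)%:E * N n y)))).
    apply: (le_integral_shift hA) => //.
    - by move=> y [].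
    - by apply: measurable_funeM.
    - by move=> y; rewrite mule_ge0.
    - by move=> y []; rewrite /eball /= subr0 => _ /negP; rewrite -leNgt => /kP.
  under eq_integral do rewrite muleCA.
  rewrite ge0_integralZl_EFin//.
  - by move=> y _; rewrite mule_ge0.
  - by apply: measurable_funTS; exact: measurable_conv_integrandx.
have Nfin : N n.+1 x \is a fin_num.
  rewrite ge0_fin_numE ?N0//; apply: le_lt_trans (numerator_le_conv_pow hA _ _ _) _.
    exact: measurable_D_set.
  by rewrite ltey_eq U1x.
move: (le_trans split1 (leeD2l _ I1)) UUx fUx.
rewrite -(fineK Ux) -(fineK U1x) -(fineK Nfin) -(fineK fx) -?EFinM -?EFinD !lee_fin.
move: (fine (U n x)) (fine (U n.+1 x)) (fine (N n.+1 x)) (fine (f x)) Ux0 fx0.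
move=> u0 u1 nu p u00 p0 /= h1 h2 h3.
have tE : (t * (2 * (1 + e)) = e)%R by rewrite divfK// gt_eqF//; lra.
have h2' : (2 * (K * L) * u0 + t * u0 <= t * u1)%R.
  have := ler_wpM2l (ltW t0) h2; rewrite mulrA mulrDr (mulrC t (_ / _))%R.
  by rewrite divfK ?gt_eqF// mulr1 mulrDl.
have h3' : (2 * (c * l) * p + t * p <= t * u1)%R.
  have := ler_wpM2l (ltW t0) h3; rewrite mulrA mulrDr (mulrC t (_ / _))%R.
  by rewrite divfK ?gt_eqF// mulr1 mulrDl.
have tu0 : (0 <= t * u0)%R by rewrite mulr_ge0// ltW.
have tp0 : (0 <= t * p)%R by rewrite mulr_ge0// ltW.
have h4 : ((1 - t) * u1 <= (1 + e / 2) * nu)%R by lra.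
have e1 : (0 < 1 + e / 2)%R by lra.
rewrite -(ler_pM2l e1).
have e2 : (0 <= 1 + e)%R by lra.
have := ler_wpM2l e2 h4.
have -> : ((1 + e) * ((1 - t) * u1) = (1 + e / 2) * u1)%R.
  rewrite mulrA; congr (_ * _)%R; lra.
lra.
Qed.

End asymptotics.

Local Open Scope ereal_scope.

(** * The limits of the ratios *)

Section limits.
Context {R : realType} {d : nat} (hd : (1 <= d)%N).
Local Notation V := 'rV[R]_d.
Local Notation mu := (lebesgue_rV d).
Variables (f : V -> \bar R) (C1 C2 : R).
Hypothesis hA : assumption_A f C1 C2.
Local Notation U n := (conv_pow f n.+1).
Local Notation L := (L1norm f).
Local Notation Nd n := (numerator f (@D_set R d) n).
Local Notation Ne n := (numerator f (@E_set R d) n).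

Lemma h_numerator n x : x != 0%R -> h_ f n.+1 x = Nd n x / f x.
Proof. by apply: (ratio_seqE hA); exact: D_set0. Qed.

Lemma g_numerator n x : x != 0%R -> g_ f n.+1 x = Ne n x / f x.
Proof. by apply: (ratio_seqE hA); exact: E_set0. Qed.

Lemma numerator_D_le_E n x : Nd n x <= Ne n x.
Proof.
apply: (numerator_mono hA); [exact: measurable_D_set|exact: measurable_E_set|].
exact: D_set_sub_E_set.
Qed.

Lemma numerator_E_le_conv_pow n x : Ne n x <= U n x.
Proof. apply: (numerator_le_conv_pow hA); exact: measurable_E_set. Qed.

Lemma h_le_g x : x != 0%R -> h_ f 2 x <= g_ f 2 x.
Proof.
move=> x0; rewrite h_numerator// g_numerator//; apply: lee_wpmul2r; last exact: numerator_D_le_E.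
by rewrite inve_ge0 (f_ge0 hA).
Qed.

(** E(x) exceeds D(x) only where one of the factors is at most C1 f x. *)
Lemma g_le_h x : (2 <= enorm x)%R -> g_ f 2 x <= h_ f 2 x + (2 * (C1 * L))%:E.
Proof.
move=> x2; have x0 : x != 0%R by apply: enorm_ge1_neq0; lra.
have fx := f_fin_num hA x0.
have fx0 : (0 < fine (f x))%R by rewrite fine_gt0// (f_gt0 hA) ltey_eq fx.
have C11 := A_C1_ge1 hA.
rewrite h_numerator// g_numerator// -(fineK fx) inver gt_eqF// lee_pdivrMr//.
rewrite muleDl// -?muleA -?EFinM ?mulVf ?gt_eqF// ?mule1; last first.
  rewrite ge0_adde_def// inE ?mule_ge0 ?(numerator_ge0 hA)// lee_fin.
    by rewrite invr_ge0 ltW.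
  by rewrite mulr_ge0// mulr_ge0 ?(L1norm_ge0 f)//; lra.
apply: (le_trans (numerator_E_le_conv_pow 1 x)); rewrite addeC.
apply: (le_trans (@conv_pow_le_D_set _ _ f C1 C2 hA 0 x (C1 * fine (f x)) x2 _ _)).
- by rewrite mulr_ge0 ?ltW//; lra.
- by move=> y xy; rewrite EFinM fineK//; exact: (f_shift1 hA).
by rewrite leeD2r// lee_fin expr1; lra.
Qed.

Lemma f_negligible_of_g : g_ f 2 x @[x --> enorm_infty d] --> +oo ->
  negligible_infty f (U 1).
Proof.
move=> /cvgeyPge gy A A0; move: (@near_enorm_ge R d 1%R) (gy A).
apply: filterS2 => x x1 Ag; have x0 := enorm_ge1_neq0 x1.
apply: le_trans (numerator_E_le_conv_pow 1 x); rewrite -(ratio_seq_numerator hA) ?E_set0//.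
by rewrite muleC lee_wpmul2l// (f_ge0 hA).
Qed.

Lemma h_cvgy_g_cvgy : h_ f 2 x @[x --> enorm_infty d] --> +oo ->
  g_ f 2 x @[x --> enorm_infty d] --> +oo.
Proof.
move=> /cvgeyPge hy; apply/cvgeyPge => A; move: (@near_enorm_ge R d 1%R) (hy A).
apply: filterS2 => x x1 /le_trans; apply; apply: h_le_g.
exact: enorm_ge1_neq0.
Qed.

Lemma g_cvgy_h_cvgy : g_ f 2 x @[x --> enorm_infty d] --> +oo ->
  h_ f 2 x @[x --> enorm_infty d] --> +oo.
Proof.
move=> /cvgeyPge gy; apply/cvgeyPge => A.
move: (@near_enorm_ge R d 2%R) (gy (A + 2 * (C1 * L))%R).
apply: filterS2 => x x2 /le_trans /(_ (g_le_h x2)).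
by rewrite EFinD leeD2rE.
Qed.

Hypothesis f_negligible : negligible_infty f (U 1).

(** Stated for any W between the numerator of h_(n+1) and the power, so as to
    cover h and g at once. *)
Lemma equiv_infty_ratio n (W r : V -> \bar R) :
  (forall x, x != 0%R -> r x = W x / f x) ->
  (forall x, Nd n x <= W x) -> (forall x, W x <= U n x) ->
  equiv_infty (fun x => U n x / f x) r.
Proof.
move=> rE NW WU.
have fpos x : (1 <= enorm x)%R -> (0 < fine (f x))%R /\ f x = (fine (f x))%:E.
  move=> x1; have fx := f_fin_num hA (enorm_ge1_neq0 x1).
  by rewrite fineK// fine_gt0// (f_gt0 hA) ltey_eq fx.
have nearN e : (0 < e)%R -> \forall x \near enorm_infty d, U n x <= (1 + e)%:E * W x.
  move=> e0; have := conv_pow_le_numerator hA f_negligible n e0.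
  apply: filterS => x /le_trans; apply; apply: lee_wpmul2l => //.
  by rewrite lee_fin; lra.
apply: equiv_infty_squeeze.
  move: (@near_enorm_ge R d 1%R) (nearN 1%R ltr01); apply: filterS2 => x x1 UW.
  have x0 := enorm_ge1_neq0 x1; have [f0 fE] := fpos _ x1.
  have U0 := conv_pow_gt0 hd hA n x1.
  have W0 : 0 < W x.
    rewrite ltNge; apply/negP => W0.
    suff : U n x <= 0 by rewrite leNgt U0.
    by apply: le_trans UW _; rewrite mule_ge0_le0// lee_fin.
  have Wfin : W x \is a fin_num.
    rewrite ge0_fin_numE ?ltW// (le_lt_trans (WU x))// ltey_eq.
    by rewrite (conv_pow_fin_num hA).
  rewrite rE//; split.
  - by rewrite fE inver gt_eqF// mule_gt0// lte_fin invr_gt0.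
  - by rewrite fE inver gt_eqF// fin_numM.
  - by rewrite lee_wpmul2r// inve_ge0 (f_ge0 hA).
move=> e e0; move: (@near_enorm_ge R d 1%R) (nearN e e0); apply: filterS2 => x x1 UW.
by rewrite rE ?enorm_ge1_neq0// muleA lee_wpmul2r// inve_ge0 (f_ge0 hA).
Qed.

Lemma conv_pow_cvgy m k : U (m + k.+1) x / U m x @[x --> enorm_infty d] --> +oo.
Proof.
apply: negligible_infty_cvgy.
  apply: filterS (@near_enorm_ge R d 1%R) => x x1; split.
    exact: (conv_pow_gt0 hd hA).
  exact/(conv_pow_fin_num hA)/enorm_ge1_neq0.
elim: k => [|k IH].
  by rewrite addn1; exact: (negligible_conv_powS hA f_negligible m).1.
apply: (negligible_infty_trans IH).
by rewrite [(m + k.+2)%N]addnS; exact: (negligible_conv_powS hA f_negligible _).1.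
Qed.

(** The Poisson series is at least its term with n + 2 factors. *)
Lemma poisson_cvgy n (l : R) : (0 < l)%R ->
  poisson_density f l x / U n x @[x --> enorm_infty d] --> +oo.
Proof.
move=> l0; apply: negligible_infty_cvgy.
  apply: filterS (@near_enorm_ge R d 1%R) => x x1; split.
    exact: (conv_pow_gt0 hd hA).
  exact/(conv_pow_fin_num hA)/enorm_ge1_neq0.
move=> A A0.
pose c := (expR (- l * L) * (l ^+ n.+2 / n.+2`!%:R))%R.
have c0 : (0 < c)%R.
  by rewrite mulr_gt0 ?expR_gt0// divr_gt0 ?exprn_gt0// ltr0n fact_gt0.
have := (negligible_conv_powS hA f_negligible n).1 _ (divr_gt0 A0 c0).
apply: filterS => x UU.
apply: (@le_trans _ _ (c%:E * U n.+1 x)).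
  rewrite -lee_pdivrMl// muleA -EFinM mulrC; exact: UU.
rewrite EFinM -muleA; apply: lee_wpmul2l; first by rewrite lee_fin expR_ge0.
have t0 k : 0 <= (l ^+ k / k`!%:R)%:E * conv_pow f k x.
  apply: mule_ge0; first by rewrite lee_fin divr_ge0// exprn_ge0// ltW.
  by case: k => // k; exact: (conv_pow_ge0 hA).
apply: le_trans (nneseries_lim_ge n.+3 (fun k _ _ => t0 k)).
rewrite big_nat_recr//= leeDr// sume_ge0// => i _; exact: t0.
Qed.

End limits.

Theorem corollary2p8 (R : realType) (d : nat) (hd : (1 <= d)%N)
    (f : 'rV[R]_d -> \bar R) (C1 C2 : R) (hA : assumption_A f C1 C2) :
  let M1 : R :=
    (fine (f (e1 d)) * fine (lebesgue_rV d (eball (0 : 'rV[R]_d) 2^-1)))%R in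
  let M2 : R := (Num.max C1 C2 * L1norm f)%R in
  (* (a) *)
  (forall C : R, (0 < C)%R -> (forall x, h_ f 2 x < C%:E) ->
    (forall (x : 'rV[R]_d) (n : nat), (1 <= enorm x)%R -> (1 <= n)%N ->
      (n%:R * (M1 / 2) ^+ n.-1)%:E * f x <= conv_pow f n x /\
      conv_pow f n x <= (n%:R * (M2 + C) ^+ n.-1)%:E * f x) /\
    (forall (x : 'rV[R]_d) (lambda : R), (1 <= enorm x)%R -> (0 < lambda)%R ->
      (expR ((M1 / 2 - L1norm f) * lambda) * lambda)%:E * f x
        <= poisson_density f lambda x /\
      poisson_density f lambda x
        <= (expR ((M2 + C - L1norm f) * lambda) * lambda)%:E * f x)) /\
  (* (b) *)
  (g_ f 2 x @[x --> enorm_infty d] --> +oo <->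
   h_ f 2 x @[x --> enorm_infty d] --> +oo) /\
  (g_ f 2 x @[x --> enorm_infty d] --> +oo \/
   h_ f 2 x @[x --> enorm_infty d] --> +oo ->
    (forall n : nat, (1 <= n)%N ->
      equiv_infty (fun x => conv_pow f n x / f x) (g_ f n) /\
      equiv_infty (fun x => conv_pow f n x / f x) (h_ f n)) /\
    (forall m n : nat, (1 <= m)%N -> (m < n)%N ->
      conv_pow f n x / conv_pow f m x @[x --> enorm_infty d] --> +oo) /\
    (forall (n : nat) (lambda : R), (1 <= n)%N -> (0 < lambda)%R ->
      poisson_density f lambda x / conv_pow f n x
        @[x --> enorm_infty d] --> +oo)).

Proof.
have L0 := L1norm_ge0 f; have C11 := A_C1_ge1 hA.
have M1_ge0 := ltW (M1_gt0 hd hA).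
move=> M1 M2; split=> [C C0 hC|].
  have M20 : (0 <= M2 + C)%R.
    rewrite addr_ge0 ?(ltW C0)// mulr_ge0// le_max; apply/orP; left; lra.
  have M12 : (0 <= M1 / 2)%R by rewrite divr_ge0.
  have lower n x : (1 <= enorm x)%R ->
      (n.+1%:R * (M1 / 2) ^+ n)%:E * f x <= conv_pow f n.+1 x.
    move=> x1; apply: le_trans (conv_pow_ge hd hA n x1).
    apply: lee_wpmul2r; first exact: (f_ge0 hA).
    rewrite lee_fin expr_div_n mulrCA ler_piMr ?exprn_ge0//.
    by rewrite ler_pdivrMr ?exprn_gt0// mul1r -natrX ler_nat ltn_expl.
  have upper n x : (1 <= enorm x)%R ->
      conv_pow f n.+1 x <= (n.+1%:R * (M2 + C) ^+ n)%:E * f x.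
    exact: (conv_pow_le hA n C0 hC).
  split=> [x [|n]// x1 _|x l x1 /ltW l0]; first by split; [exact: lower|exact: upper].
  have x0 := enorm_ge1_neq0 x1.
  split; first by apply: (poisson_density_ge hA) => // n; exact: lower.
  by apply: (poisson_density_le hA) => // n; exact: upper.
split; first by split; [exact: (g_cvgy_h_cvgy hA)|exact: (h_cvgy_g_cvgy hA)].
move=> gh; have fU : negligible_infty f (conv_pow f 2).
  by case: gh => [|/(h_cvgy_g_cvgy hA)]; exact: (f_negligible_of_g hA).
split; [|split].
- move=> [//|n] _; split.
    apply: (equiv_infty_ratio hd hA fU (W := numerator f (@E_set R d) n)).
    + by move=> x; exact: (g_numerator hA).
    + exact: (numerator_D_le_E hA).
    + exact: (numerator_E_le_conv_pow hA).
  apply: (equiv_infty_ratio hd hA fU (W := numerator f (@D_set R d) n)) => //.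
  + by move=> x; exact: (h_numerator hA).
  + by move=> x; apply: (numerator_le_conv_pow hA); exact: measurable_D_set.
- move=> [//|m] [//|n] _; rewrite ltnS => mn.
  by rewrite -(subnKC mn) addSnnS; exact: (conv_pow_cvgy hd hA fU).
- by move=> [//|n] l _ l0; exact: (poisson_cvgy hd hA fU).
Qed.
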